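(* Let $q\in(1,\infty)\setminus\{2\}$ and let $\mathbb{Z}^2$ act on $\mathbb{R}^2$ by translations along a lattice $\{a\omega_1+b\omega_2: a,b\in\mathbb{Z}\}$ (with $\omega_1,\omega_2$ linearly independent). Let $(G,m)$ be a $\mathbb{Z}^2$-gain graph and let $(\tilde G,\tilde p)$ be a $\mathbb{Z}^2$-regular framework in $(\mathbb{R}^2,\|\cdot\|_q)$ derived from $(G,m)$. Then $(\tilde G,\tilde p)$ is minimally $\mathbb{Z}^2$-symmetrically (i.e. periodically, with fixed lattice) infinitesimally rigid if and only if the multigraph $G$ is $(2,2)$-tight.
   Context: $\|(a_1,a_2)\|_q=(|a_1|^q+|a_2|^q)^{1/q}$. For $a\in\mathbb{R}^2$ and $k>0$ put $a^{(k)}=(\mathrm{sgn}(a_1)|a_1|^k,\mathrm{sgn}(a_2)|a_2|^k)$. For a (possibly infinite) graph $\tilde G=(\tilde V,\tilde E)$ and $\tilde p:\tilde V\to\mathbb{R}^2$ with $\tilde p(x)\neq\tilde p(y)$ for every edge $\{x,y\}$, an infinitesimal motion in $(\mathbb{R}^2,\|\cdot\|_q)$ is a map $u:\tilde V\to\mathbb{R}^2$ with $(\tilde p(x)-\tilde p(y))^{(q-1)}\cdot(u(x)-u(y))=0$ for all edges $\{x,y\}$; trivial infinitesimal motions are the constant maps (translations). Let $\Gamma$ be a group of isometries of the plane. A $\Gamma$-gain graph $(G,m)$ is a finite multigraph $G=(V,E)$ (loops and parallel edges allowed) with each edge oriented and given a gain $m(e)\in\Gamma$, such that parallel edges with the same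 orientation have distinct gains and loops have non-identity gains; $(v_i,v_j;g)$ denotes an edge from $v_i$ to $v_j$ with gain $g$ (reversing orientation and inverting the gain gives the same edge). Its derived graph $\tilde G$ has vertex set $\{\gamma v:\gamma\in\Gamma, v\in V\}$ and, for each edge $(v_i,v_j;g)$ and each $\gamma\in\Gamma$, an edge $\{\gamma v_i,\gamma g v_j\}$ (these edges form the edge orbit of that edge). A configuration $p:V\to\mathbb{R}^2$ derives $\tilde p(\gamma v)=\gamma p(v)$ (required to give distinct endpoints on edges), and $(\tilde G,\tilde p)$ is the derived $\Gamma$-symmetric framework. A $\Gamma$-symmetric infinitesimal motion is an infinitesimal motion $u$ with $u(\gamma x)=\gamma_l u(x)$ for all $\gamma,x$, where $\gamma_l$ is the linear part of $\gamma$. The framework is $\Gamma$-symmetrically infinitesimally rigid if every $\Gamma$-symmetric infinitesimal motion is trivial, and minimally so if in addition removing any single edge orbit gives a framework that is not. $\tilde p$ is $\Gamma$-regular if the dimension of the space of $\Gamma$-symmetric infinitesimal motions is minimal among all $\Gamma$-symmetric configurations of $\tilde G$. A multigraph is $(k,l)$-sparse if every subgraph with $|E'|\ge1$ edges satisfies $|E'|\le k|V'|-l$, and $(k,l)$-tight if moreover $|E|=k|V|-l$. *)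

(* Defs.v *)
From HB Require Import structures.
From mathcomp Require Import all_boot all_order all_algebra.
From mathcomp Require Import boolp classical_sets functions reals exp.

Set Implicit Arguments.
Unset Strict Implicit.
Unset Printing Implicit Defensive.

Import Order.TTheory GRing.Theory Num.Theory.

Local Open Scope ring_scope.

(* Loops and parallel edges are allowed.  The orientation (src, tgt) is only
   a reference orientation: it matters for reading gains. *)
Record multigraph := Multigraph {
  vertex : finType;
  edge : finType;
  src : edge -> vertex;
  tgt : edge -> vertex }.

Section Sparsity.
Variables (k l : nat) (G : multigraph).

Definition is_subgraph (V' : {set vertex G}) (E' : {set edge G}) : Prop :=
  forall e, e \in E' -> src e \in V' /\ tgt e \in V'.

(* The counts are taken in int, where subtraction is not truncated. *)
Definition sparse : Prop :=
  forall (V' : {set vertex G}) (E' : {set edge G}),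
    is_subgraph V' E' -> (1 <= #|E'|)%N ->
    #|E'|%:Z <= k%:Z * #|V'|%:Z - l%:Z.

Definition tight : Prop :=
  sparse /\ #|edge G|%:Z = k%:Z * #|vertex G|%:Z - l%:Z.

End Sparsity.

Definition Z2 : zmodType := (int * int)%type.

Section GainGraph.
Variables (G : multigraph) (m : edge G -> Z2).

(* (v, w; g) and (w, v; - g) are the same edge, so distinct edges must also
   have distinct gains after one of them has been reversed; for two loops at
   the same vertex both of the first two clauses apply. *)
Definition is_gain : Prop :=
  [/\ forall e f, e != f -> src e = src f -> tgt e = tgt f -> m e <> m f,
      forall e f, e != f -> src e = tgt f -> tgt e = src f -> m e <> - m f
    & forall e, src e = tgt e -> m e <> 0].

(* The pair (g, v) stands for the vertex g v of the derived graph. *)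
Definition derived_vertex : Type := (Z2 * vertex G)%type.

Definition vertex_act (g : Z2) (x : derived_vertex) : derived_vertex :=
  (g + x.1, x.2).

Definition edge_orbit (e : edge G) (x y : derived_vertex) : Prop :=
  exists g : Z2,
    (x = (g, src e) /\ y = (g + m e, tgt e)) \/
    (y = (g, src e) /\ x = (g + m e, tgt e)).

Definition derived_adj (x y : derived_vertex) : Prop :=
  exists e, edge_orbit e x y.

Definition derived_adj_minus (e : edge G) (x y : derived_vertex) : Prop :=
  derived_adj x y /\ ~ edge_orbit e x y.

End GainGraph.

Section Motions.
Variables (R : realType) (q : R).

Definition pow_vec (k : R) (a : 'rV[R]_2) : 'rV[R]_2 :=
  \row_i (Num.sg (a 0 i) * `|a 0 i| `^ k).

Definition dot (a b : 'rV[R]_2) : R := \sum_i a 0 i * b 0 i.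

Variables (X : Type) (adj : X -> X -> Prop) (p : X -> 'rV[R]_2).

Definition is_placement : Prop := forall x y, adj x y -> p x <> p y.

Definition inf_motion (u : X -> 'rV[R]_2) : Prop :=
  forall x y, adj x y -> dot (pow_vec (q - 1) (p x - p y)) (u x - u y) = 0.

Definition trivial_motion (u : X -> 'rV[R]_2) : Prop :=
  exists c, forall x, u x = c.

End Motions.

Definition has_dim (R : realType) (W : lmodType R) (S : set W) (n : nat) :
    Prop :=
  exists b : 'I_n -> W,
    (forall c : 'I_n -> R, \sum_i c i *: b i = 0 -> forall i, c i = 0) /\
    (forall w, S w <-> exists c : 'I_n -> R, w = \sum_i c i *: b i).

Definition lattice_act (R : realType) (w1 w2 : 'rV[R]_2) (g : Z2)
    (a : 'rV[R]_2) : 'rV[R]_2 :=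
  a + (w1 *~ g.1 + w2 *~ g.2).

Definition linear_part (R : realType) (f : 'rV[R]_2 -> 'rV[R]_2)
    (a : 'rV[R]_2) : 'rV[R]_2 :=
  f a - f 0.

(* In this section rho is the action of Z^2 on the plane. *)
Section SymmetricFrameworks.
Variables (R : realType) (q : R) (rho : Z2 -> 'rV[R]_2 -> 'rV[R]_2).
Variables (G : multigraph) (m : edge G -> Z2).

Definition derived_placement (p : vertex G -> 'rV[R]_2) :
    derived_vertex G -> 'rV[R]_2 :=
  fun x => rho x.1 (p x.2).

Definition is_configuration (p : vertex G -> 'rV[R]_2) : Prop :=
  is_placement (derived_adj m) (derived_placement p).

Definition sym_inf_motion (adj : derived_vertex G -> derived_vertex G -> Prop)
    (p : vertex G -> 'rV[R]_2) (u : derived_vertex G -> 'rV[R]_2) : Prop :=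
  inf_motion q adj (derived_placement p) u /\
  forall g x, u (vertex_act g x) = linear_part (rho g) (u x).

Definition sym_inf_rigid (adj : derived_vertex G -> derived_vertex G -> Prop)
    (p : vertex G -> 'rV[R]_2) : Prop :=
  forall u, sym_inf_motion adj p u -> trivial_motion u.

Definition min_sym_inf_rigid (p : vertex G -> 'rV[R]_2) : Prop :=
  sym_inf_rigid (derived_adj m) p /\
  forall e, ~ sym_inf_rigid (derived_adj_minus m e) p.

Definition sym_motion_dim (p : vertex G -> 'rV[R]_2) (n : nat) : Prop :=
  has_dim (sym_inf_motion (derived_adj m) p) n.

Definition regular (p : vertex G -> 'rV[R]_2) : Prop :=
  exists2 n, sym_motion_dim p n &
    forall p' n', is_configuration p' -> sym_motion_dim p' n' -> (n <= n')%N.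

End SymmetricFrameworks.

(* Main.v *)
Require Import Defs.
From HB Require Import structures.
From mathcomp Require Import all_boot all_order all_algebra.
From mathcomp Require Import boolp classical_sets functions reals exp.
From mathcomp Require Import filter topology normedtype ring lra zify.

(* A symmetric motion is determined by its values on one copy of the vertices,
   each edge of G contributing one row.  Rigidity and minimality give the count
   and the sparsity by linear algebra.  Conversely it suffices, by regularity, to
   find one rigid placement of a (2,2)-tight gain graph, which is done by
   induction on the number of vertices.  There is a vertex v of degree 2 or 3.
   A vertex of degree 2 fixes itself.  If v has degree 3, some pair a, b of its
   neighbours lies in no tight subgraph of G - v, so adding an edge ab with a new
   gain to G - v keeps it tight, and G - v has, up to translation, one flex u at
   a placement that is rigid for the extended graph, with u a <> u b.  It remains
   to place v so that its three edges block that flex.  The relevant 3 x 3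
   determinant grows, as one coordinate of v tends to infinity, like a
   combination of shifts of the signed power of exponent k = q - 1, and for
   k <> 1 three such shifts admit no relation with coefficients of sum zero,
   because s^k + t^k <> (s + t)^k. *)

Set Implicit Arguments.
Unset Strict Implicit.
Unset Printing Implicit Defensive.

Import Order.TTheory GRing.Theory Num.Theory.
Import numFieldNormedType.Exports.

Local Open Scope ring_scope.

(** * Signed powers *)

Section SignedPower.
Variables (R : realType) (k : R).
Hypothesis k0 : 0 < k.

Definition spow (s : R) : R := Num.sg s * `|s| `^ k.

Lemma spow0 : spow 0 = 0.
Proof. by rewrite /spow sgr0 mul0r. Qed.

Lemma spowN s : spow (- s) = - spow s.
Proof. by rewrite /spow sgrN normrN mulNr. Qed.

Lemma spowM s t : spow (s * t) = spow s * spow t.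
Proof. by rewrite /spow sgrM normrM powRM // mulrACA. Qed.

Lemma spow1 : spow 1 = 1.
Proof. by rewrite /spow sgr1 normr1 powR1 mulr1. Qed.

Lemma spow_gt0E s : 0 < s -> spow s = s `^ k.
Proof. by move=> s0; rewrite /spow gtr0_sg // gtr0_norm // mul1r. Qed.

Lemma spow_gt0 s : 0 < s -> 0 < spow s.
Proof. by move=> s0; rewrite spow_gt0E // powR_gt0. Qed.

Lemma spow_lt : {homo spow : s t / s < t}.
Proof.
have pos s t : 0 < s -> s < t -> spow s < spow t.
  move=> s0 st; have t0 := lt_trans s0 st.
  by rewrite !spow_gt0E // gt0_ltr_powR ?nnegrE ?ltW.
move=> s t st; have [s0|s0|s0] := ltgtP 0 s; first exact: pos.
- have [t0|t0|t0] := ltgtP 0 t.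
  + apply: (@lt_trans _ _ 0); last exact: spow_gt0.
    by rewrite -oppr_gt0 -spowN spow_gt0 ?oppr_gt0.
  + by rewrite -ltrN2 -!spowN pos ?oppr_gt0 ?ltrN2.
  + by rewrite -t0 spow0 -oppr_gt0 -spowN spow_gt0 ?oppr_gt0.
- by move: st; rewrite -s0 spow0; exact: spow_gt0.
Qed.

Lemma spow_le : {mono spow : s t / s <= t}.
Proof. exact: le_mono spow_lt. Qed.

Lemma spow_inj : injective spow.
Proof. exact: (inc_inj spow_le). Qed.

Lemma spow_eq0 s : (spow s == 0) = (s == 0).
Proof. by rewrite -{1}spow0 (inj_eq spow_inj). Qed.

End SignedPower.

(** * Continuity of signed powers and independence of three shifts *)

Section SignedPowerContinuity.
Variables (R : realType) (k : R).
Hypothesis k0 : 0 < k.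

Lemma spowK : cancel (spow k^-1) (@spow R k).
Proof.
have ki : 0 < k^-1 by rewrite invr_gt0.
have pos s : 0 < s -> spow k (spow k^-1 s) = s.
  move=> s0; rewrite spow_gt0E ?spow_gt0 // spow_gt0E // -powRrM.
  by rewrite mulVf ?gt_eqF // powRr1 // ltW.
move=> s; have [s0|s0|<-] := ltgtP 0 s; first exact: pos.
- by rewrite -[s]opprK spowN spowN pos ?oppr_gt0.
- by rewrite !spow0.
Qed.

(** A strictly increasing bijection is continuous: the preimages of [spow k a - e] and
    [spow k a + e] bracket a neighbourhood of [a]. *)
Lemma spow_continuous : continuous (@spow R k).
Proof.
have ki : 0 < k^-1 by rewrite invr_gt0.
move=> a; apply/cvgrPdist_lt => e e0.
have lo : spow k^-1 (spow k a - e) < a.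
  by rewrite -(leW_mono (spow_le k0)) spowK ltrBlDr ltrDl.
have hi : a < spow k^-1 (spow k a + e).
  by rewrite -(leW_mono (spow_le k0)) spowK ltrDl.
near=> s.
have h1 : spow k^-1 (spow k a - e) < s by near: s; apply: lt_nbhsr.
have h2 : s < spow k^-1 (spow k a + e) by near: s; apply: lt_nbhsl.
move: h1 h2; rewrite -(leW_mono (spow_le k0)) spowK => h1.
by rewrite -(leW_mono (spow_le k0)) spowK => h2; rewrite ltr_distlC h1 h2.
Unshelve. all: by end_near. Qed.

Hypothesis k1 : k != 1.

(** Dividing by [s + t] reduces to [a + b = 1] with [a] and [b] in (0, 1). There the power of
    exponent [k] lies strictly above the identity if [k < 1] and strictly below it if [k > 1], so
    the two powers cannot sum to 1. *)
Lemma powR_additive_false (s t : R) :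
  0 < s -> 0 < t -> s `^ k + t `^ k != (s + t) `^ k.
Proof.
move=> s0 t0; have st0 : 0 < s + t by rewrite addr_gt0.
have strict u : 0 < u -> u < 1 -> k < 1 -> u < u `^ k.
  move=> u0 u1 kl; rewrite -[ltLHS]powRr1 ?ltW // /powR gt_eqF //.
  by rewrite ltr_expR ltr_nM2r // ln_lt0 // u0.
have strict' u : 0 < u -> u < 1 -> 1 < k -> u `^ k < u.
  move=> u0 u1 kl; rewrite -[ltRHS]powRr1 ?ltW // /powR gt_eqF //.
  by rewrite ltr_expR ltr_nM2r // ln_lt0 // u0.
pose a := s / (s + t); pose b := t / (s + t).
have a0 : 0 < a by rewrite divr_gt0.
have b0 : 0 < b by rewrite divr_gt0.
have ab : a + b = 1 by rewrite -mulrDl divff ?gt_eqF.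
have a1 : a < 1 by rewrite -ab ltrDl.
have b1 : b < 1 by rewrite -ab ltrDr.
have es : s `^ k = a `^ k * (s + t) `^ k.
  by rewrite -powRM ?ltW // divfK ?gt_eqF.
have et : t `^ k = b `^ k * (s + t) `^ k.
  by rewrite -powRM ?ltW // divfK ?gt_eqF.
rewrite es et -mulrDl -[X in _ != X]mul1r.
have st_neq0 : (s + t) `^ k != 0 by rewrite gt_eqF ?powR_gt0.
rewrite (inj_eq (mulIf st_neq0)).
have [kl|kg|ke] := ltgtP k 1; last by case/eqP: k1.
- have := strict _ a0 a1 kl; have := strict _ b0 b1 kl.
  by move=> h1 h2; apply/eqP => e; lra.
- have := strict' _ a0 a1 kg; have := strict' _ b0 b1 kg.
  by move=> h1 h2; apply/eqP => e; lra.
Qed.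

(** Two of the three numbers have the same sign and the third is minus their sum, so failure of
    additivity applies. *)
Lemma spow_sum3_neq0 (a b c : R) : a != 0 -> b != 0 -> c != 0 ->
  a + b + c = 0 -> spow k a + spow k b + spow k c != 0.
Proof.
have two s t : 0 < s -> 0 < t -> spow k s + spow k t + spow k (- (s + t)) != 0.
  move=> s0 t0; have st0 : 0 < s + t by rewrite addr_gt0.
  rewrite spowN !spow_gt0E // subr_eq0; exact: powR_additive_false.
have two' s t : s < 0 -> t < 0 -> spow k s + spow k t + spow k (- (s + t)) != 0.
  move=> s0 t0; have := two (- s) (- t).
  rewrite !oppr_gt0 => /(_ s0 t0); rewrite -opprD !spowN.
  by rewrite -!opprD oppr_eq0.
have same s t u : 0 < s * t -> s + t + u = 0 ->
    spow k s + spow k t + spow k u != 0.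
  move=> st0 stu; have -> : u = - (s + t) by lra.
  have [s0|s0|s0] := ltgtP 0 s.
  - by apply: two => //; rewrite pmulr_rgt0 in st0.
  - by apply: two' => //; rewrite nmulr_rgt0 in st0.
  - by rewrite -s0 mul0r ltxx in st0.
move=> a0 b0 c0 abc.
have [ab|ab] := ltP 0 (a * b); first exact: same.
have [bc|bc] := ltP 0 (b * c).
  by rewrite -addrA addrC same // addrAC -addrA addrC; lra.
have [ac|ac] := ltP 0 (a * c).
  by rewrite addrAC same //; lra.
have : 0 < a ^+ 2 by rewrite exprn_even_gt0.
nra.
Qed.

(** Evaluation at [y1] and at [y2] removes one term each. Combined with the zero sum of the
    coefficients this leaves [c3] times the sum of the signed powers of three nonzero differences
    that add up to zero. *)
Lemma spow_shift_indep (c1 c2 c3 y1 y2 y3 : R) :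
  y1 != y2 -> y2 != y3 -> y3 != y1 -> c1 + c2 + c3 = 0 ->
  (forall y, c1 * spow k (y - y1) + c2 * spow k (y - y2) + c3 * spow k (y - y3)
    = 0) ->
  [/\ c1 = 0, c2 = 0 & c3 = 0].
Proof.
move=> y12 y23 y31 c0 H.
set a := spow k (y1 - y2); set b := spow k (y2 - y3); set c := spow k (y3 - y1).
have a0 : a != 0 by rewrite spow_eq0 // subr_eq0.
have abc : a + b + c != 0.
  by apply: spow_sum3_neq0; rewrite ?subr_eq0 //; lra.
have h1 := H y1; have h2 := H y2.
rewrite subrr spow0 -(opprB y3 y1) spowN -/a -/c in h1.
rewrite subrr spow0 -(opprB y1 y2) spowN -/a -/b in h2.
have c30 : c3 = 0.
  have : c3 * (a + b + c) = 0.
    have -> : c3 * (a + b + c) = a * (c1 + c2 + c3) + (- c1 * a + c2 * 0 + c3 * b)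
      - (c1 * 0 + c2 * a + c3 * - c) by ring.
    by rewrite c0 h1 mulNr -mulrN h2; ring.
  by move/eqP; rewrite mulf_eq0 (negPf abc) orbF => /eqP.
have c20 : c2 = 0.
  have : c2 * a = 0 by move: h1; rewrite c30; lra.
  by move/eqP; rewrite mulf_eq0 (negPf a0) orbF => /eqP.
by split => //; lra.
Qed.

End SignedPowerContinuity.

(** * Perturbation off a finite set *)

Section RightNeighbours.
Local Open Scope classical_set_scope.

(** Moves a nonvanishing point off a prescribed finite set. The strict inequality [a < s] allows the
    result to be inverted when [a = 0]. *)
Lemma continuous_neq0_right (R : realType) (h : R -> R) (a : R) (N : seq R) :
  {for a, continuous h} -> h a != 0 -> exists s, [/\ a < s, s \notin N & h s != 0].
Proof.
move=> ch ha.
have hN : \forall s \near a^'+, s \notin N.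
  elim: N => [|n N IH]; first exact: nearW.
  have [na|an] := leP n a; near=> s; rewrite inE negb_or;
    (apply/andP; split; last by near: s).
    have : a < s by near: s; exact: nbhs_right_gt.
    by move=> /(le_lt_trans na) /gt_eqF ->.
  have : s < n by near: s; exact: nbhs_right_lt.
  by move=> /lt_eqF ->.
have hh : \forall s \near a^'+, h s != 0.
  by apply: (cvgr_neq0 (h a)) => //; exact: cvg_at_right_filter.
have [s [[h1 h2] h3]] : exists s, (a < s /\ s \notin N) /\ h s != 0.
  apply: (@filter_ex _ (at_right a)).
  near=> s; split; [split|]; near: s => //; exact: nbhs_right_gt.
by exists s.
Unshelve. all: by end_near. Qed.

End RightNeighbours.

(** * The determinant that decides whether a flex is blocked *)

Section FlexDeterminant.
Variables (R : realType) (k : R).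
Hypotheses (k0 : 0 < k) (k1 : k != 1).

(* The determinant of the rows [(a_i, b_i, a_i al_i + b_i be_i)], i = 1, 2, 3. *)
Definition flex_det (a1 a2 a3 b1 b2 b3 al1 al2 al3 be1 be2 be3 : R) : R :=
  (al1 - al2) * a1 * a2 * b3 + (al3 - al1) * a1 * a3 * b2 +
  (al2 - al3) * a2 * a3 * b1 + (be1 - be3) * a2 * b1 * b3 +
  (be3 - be2) * a1 * b2 * b3 + (be2 - be1) * a3 * b1 * b2.

(* As [x] tends to infinity the determinant grows like [x ^ (2k)] times a
   combination of shifted powers of [y]; the substitution [x = 1/s] turns this
   into continuity at [s = 0]. *)
Lemma flex_det_neq0_of_fst (x1 x2 x3 y1 y2 y3 al1 al2 al3 be1 be2 be3 : R)
    (N : seq R) :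
  y1 != y2 -> y2 != y3 -> y3 != y1 -> ~ (al1 = al2 /\ al2 = al3) ->
  exists x y, [/\ x \notin N, y \notin N &
    flex_det (spow k (x - x1)) (spow k (x - x2)) (spow k (x - x3))
             (spow k (y - y1)) (spow k (y - y2)) (spow k (y - y3))
             al1 al2 al3 be1 be2 be3 != 0].
Proof.
move=> y12 y23 y31 hal.
have sc := @spow_continuous R k k0.
(* The leading coefficient as [x] grows; its coefficients sum to zero and, by [hal], do not all
   vanish. *)
pose g y := (al2 - al3) * spow k (y - y1) + (al3 - al1) * spow k (y - y2) +
  (al1 - al2) * spow k (y - y3).
have cD (f f' : R -> R) : continuous f -> continuous f' ->
    continuous (fun x => f x + f' x).
  by move=> cf cf' x; apply: cvgD; [exact: cf|exact: cf'].
have cM (f f' : R -> R) : continuous f -> continuous f' ->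
    continuous (fun x => f x * f' x).
  by move=> cf cf' x; apply: cvgM; [exact: cf|exact: cf'].
have cS (f : R -> R) : continuous f -> continuous (fun x => spow k (f x)).
  by move=> cf x; apply: (@continuous_comp _ _ _ f); [exact: cf|exact: sc].
have cC (c : R) : continuous (fun _ : R => c) by exact: cst_continuous.
have cI : continuous (fun x : R => x) by move=> x; exact: cvg_id.
have gc : continuous g.
  have cs c : continuous (fun y : R => spow k (y - c)) by apply/cS/cD.
  have t c d := cM _ _ (cC c) (cs d).
  exact: cD _ _ (cD _ _ (t _ _) (t _ _)) (t _ _).
have [y0 gy0] : exists y, g y != 0.
  apply/not_existsP => H; apply: hal.
  have [|||||h1 h2 h3] := @spow_shift_indep R k k0 k1 (al2 - al3) (al3 - al1)
    (al1 - al2) y1 y2 y3; rewrite ?y12 //.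
  - by ring.
  - by move=> y; apply/eqP; rewrite -[_ == _]negbK; apply/negP/H.
  - by split; lra.
have [y [_ yN gy]] := continuous_neq0_right N (gc y0) gy0.
(* For [s > 0] this is [spow k s ^+ 2] times the determinant at [x = s^-1]; the formula also makes
   sense at [s = 0], where it equals [g y]. *)
pose h s :=
  let a1 := spow k (1 - s * x1) in let a2 := spow k (1 - s * x2) in
  let a3 := spow k (1 - s * x3) in let b1 := spow k (y - y1) in
  let b2 := spow k (y - y2) in let b3 := spow k (y - y3) in
  (al1 - al2) * b3 * (a1 * a2) + (al3 - al1) * b2 * (a1 * a3) +
  (al2 - al3) * b1 * (a2 * a3) +
  spow k s * ((be1 - be3) * b1 * b3 * a2 + (be3 - be2) * b2 * b3 * a1 +
    (be2 - be1) * b1 * b2 * a3).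
have hc : continuous h.
  have cs c : continuous (fun s : R => spow k (1 - s * c)).
    apply/cS/cD => //; have -> : (fun s => - (s * c)) = (fun s => s * - c).
      by apply/funext => s; rewrite mulrN.
    exact: cM.
  have cs0 : continuous (fun s : R => spow k s) by exact: sc.
  have t c d := cM _ _ (cC c) (cs d).
  have t2 c d d' := cM _ _ (cC c) (cM _ _ (cs d) (cs d')).
  exact: cD _ _ (cD _ _ (cD _ _ (t2 _ _ _) (t2 _ _ _)) (t2 _ _ _))
    (cM _ _ cs0 (cD _ _ (cD _ _ (t _ _) (t _ _)) (t _ _))).
have h0 : h 0 != 0.
  suff -> : h 0 = g y by [].
  by rewrite /h /g /= !mul0r !subr0 spow1 spow0; ring.
(* Avoiding the inverses of [N] makes [s^-1] avoid [N]. *)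
have [s [s0 sN hs]] := continuous_neq0_right (map (fun n => n^-1) N) (hc 0) h0.
exists s^-1, y; split => //.
  by apply: contra sN => sN; apply/mapP; exists s^-1 => //; rewrite invrK.
have e c : spow k (1 - s * c) = spow k s * spow k (s^-1 - c).
  by rewrite -spowM mulrBr divff ?gt_eqF.
apply: contra hs => /eqP hs; apply/eqP; rewrite /h /= !e.
set a1 := spow k (_ - x1) in hs *; set a2 := spow k (_ - x2) in hs *.
set a3 := spow k (_ - x3) in hs *.
rewrite -[RHS](mulr0 (spow k s ^+ 2)) -hs /flex_det; ring.
Qed.

(** If the first coordinates [al] agree then the second ones do not, and the roles of [x] and [y]
    are exchanged: swapping the first two columns and negating the third preserves the
    determinant. *)
Lemma flex_det_neq0 (x1 x2 x3 y1 y2 y3 al1 al2 al3 be1 be2 be3 : R)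
    (N : seq R) :
  x1 != x2 -> x2 != x3 -> x3 != x1 -> y1 != y2 -> y2 != y3 -> y3 != y1 ->
  ~ [/\ al1 = al2, al2 = al3, be1 = be2 & be2 = be3] ->
  exists x y, [/\ x \notin N, y \notin N &
    flex_det (spow k (x - x1)) (spow k (x - x2)) (spow k (x - x3))
             (spow k (y - y1)) (spow k (y - y2)) (spow k (y - y3))
             al1 al2 al3 be1 be2 be3 != 0].
Proof.
move=> x12 x23 x31 y12 y23 y31 hab.
have [[e1 e2]|hal] := EM (al1 = al2 /\ al2 = al3); last first.
  exact: flex_det_neq0_of_fst.
have [|y [x [yN xN H]]] := @flex_det_neq0_of_fst y1 y2 y3 x1 x2 x3
    (- be1) (- be2) (- be3) (- al1) (- al2) (- al3) N x12 x23 x31.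
  by move=> [/oppr_inj e3 /oppr_inj e4]; apply: hab.
exists x, y; split => //; apply: contra H => /eqP H.
by rewrite -H /flex_det; apply/eqP; ring.
Qed.

Lemma avoid_finite (N : seq R) : exists x, x \notin N.
Proof.
have [|s [_ sN _]] := @continuous_neq0_right R (fun=> 1) 0 N _ (oner_neq0 R).
  exact: cst_continuous.
by exists s.
Qed.

Lemma avoid_inj_value (f : R -> R) (c : R) : injective f ->
  exists x0, forall x, x != x0 -> f x != c.
Proof.
move=> fI; have [[x0 <-]|H] := EM (exists x, f x = c).
  by exists x0 => x; apply: contra => /eqP /fI ->.
by exists 0 => x _; apply/eqP => e; apply: H; exists x.
Qed.

(** By multiplicativity and injectivity of [spow], the determinant vanishes exactly when the same
    expression without powers does. That is an affine equation in [x] with at most one solution. *)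
Lemma spow_rows_indep (x1 x2 y1 y2 y : R) : (x1, y1) != (x2, y2) -> y != y1 ->
  exists x0, forall x, x != x0 ->
  spow k (x - x1) * spow k (y - y2) - spow k (x - x2) * spow k (y - y1) != 0.
Proof.
move=> P12 yy1.
have lin x : (spow k (x - x1) * spow k (y - y2) -
    spow k (x - x2) * spow k (y - y1) == 0) =
    ((y1 - y2) * x == x1 * (y - y2) - x2 * (y - y1)).
  rewrite -!spowM subr_eq0 (inj_eq (spow_inj k0)) -subr_eq0 -[in RHS]subr_eq0.
  by congr (_ == 0); ring.
have [ye|yne] := eqVneq y1 y2.
  exists 0 => x _; rewrite lin ye subrr mul0r eq_sym -mulrBl mulf_eq0.
  rewrite -ye !subr_eq0 (negPf yy1) orbF.
  by apply: contra P12 => /eqP ->; rewrite ye.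
exists ((x1 * (y - y2) - x2 * (y - y1)) / (y1 - y2)) => x; rewrite lin.
by apply: contra => /eqP <-; rewrite mulrC mulKf // subr_eq0.
Qed.

(** Once [y] is chosen off [y1] and [y3], each of the two conditions excludes at most one value of
    [x]. *)
Lemma spow_rows_neq0 (x1 x2 x3 y1 y2 y3 al be : R) (N : seq R) :
  (x1, y1) != (x2, y2) -> (al, be) != (0, 0) ->
  exists x y, [/\ x \notin N, y \notin N,
    spow k (x - x1) * spow k (y - y2) - spow k (x - x2) * spow k (y - y1) != 0 &
    al * spow k (x - x3) + be * spow k (y - y3) != 0].
Proof.
move=> P12 ab.
have [y] := avoid_finite [:: y1, y3 & N].
rewrite !inE !negb_or => /and3P[yy1 yy3 yN].
have [xa Ha] := spow_rows_indep P12 yy1.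
have [xb Hb] : exists x0, forall x, x != x0 ->
    al * spow k (x - x3) + be * spow k (y - y3) != 0.
  have [al0|al0] := eqVneq al 0.
    exists 0 => x _; rewrite al0 mul0r add0r mulf_neq0 //.
      by apply: contra ab => /eqP ->; rewrite al0.
    by rewrite spow_eq0 // subr_eq0.
  have [|x0 H] := @avoid_inj_value (fun x => al * spow k (x - x3))
      (- (be * spow k (y - y3))).
    by move=> u v /(mulfI al0) /(spow_inj k0) /addIr.
  by exists x0 => x /H; rewrite addr_eq0.
have [x] := avoid_finite [:: xa, xb & N].
rewrite !inE !negb_or => /and3P[xxa xxb xN].
by exists x, y; split; auto.
Qed.

End FlexDeterminant.

(** * Blocking a flex by the position of one vertex *)

Section Rows.
Variables (R : realType) (k : R).
Hypotheses (k0 : 0 < k) (k1 : k != 1).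
Implicit Types (P U z w : 'rV[R]_2).

Lemma ord2P (i : 'I_2) : i = 0 \/ i = 1.
Proof. by case: i => [[|[|//]] ?]; [left|right]; apply/val_inj. Qed.

Lemma row2_eq P U : P 0 0 = U 0 0 -> P 0 1 = U 0 1 -> P = U.
Proof.
by move=> e0 e1; apply/rowP => i; case: (ord2P i) => ->.
Qed.

Lemma row2_pair_neq P U : P != U -> (P 0 0, P 0 1) != (U 0 0, U 0 1).
Proof. by apply: contra => /eqP[e0 e1]; apply/eqP/row2_eq. Qed.

Lemma dotE (a b : 'rV[R]_2) : dot a b = a 0 0 * b 0 0 + a 0 1 * b 0 1.
Proof.
rewrite /dot !big_ord_recl big_ord0 addr0.
by have -> : lift ord0 ord0 = 1 :> 'I_2 by apply/val_inj.
Qed.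

Lemma dot_pow_vec z P U : dot (pow_vec k (z - P)) U =
  spow k (z 0 0 - P 0 0) * U 0 0 + spow k (z 0 1 - P 0 1) * U 0 1.
Proof. by rewrite dotE !mxE. Qed.

Lemma dotDr (a b c : 'rV[R]_2) : dot a (b + c) = dot a b + dot a c.
Proof. by rewrite !dotE !mxE; ring. Qed.

Lemma dotZr (a b : 'rV[R]_2) (c : R) : dot a (c *: b) = c * dot a b.
Proof. by rewrite !dotE !mxE; ring. Qed.

Lemma dotNr (a b : 'rV[R]_2) : dot a (- b) = - dot a b.
Proof. by rewrite !dotE !mxE; ring. Qed.

Lemma dotNl (a b : 'rV[R]_2) : dot (- a) b = - dot a b.
Proof. by rewrite !dotE !mxE; ring. Qed.

Lemma pow_vecN (a : 'rV[R]_2) : pow_vec k (- a) = - pow_vec k a.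
Proof. by apply/rowP => i; rewrite !mxE sgrN normrN mulNr. Qed.

Definition avoids z (N : seq R) := forall i, z 0 i \notin N.

Definition mkrow (x y : R) : 'rV[R]_2 := \row_i (if i == 0 then x else y).

Lemma avoids_mkrow x y N : x \notin N -> y \notin N -> avoids (mkrow x y) N.
Proof. by move=> xN yN i; rewrite mxE; case: ifP. Qed.

Lemma mkrow0 x y : mkrow x y 0 0 = x. Proof. by rewrite mxE. Qed.
Lemma mkrow1 x y : mkrow x y 0 1 = y. Proof. by rewrite mxE. Qed.

(** The new vertex sits at [z] with velocity [w]; its three neighbours sit at the [P]s and follow
    the flex [l *: U]. The three edges then admit only the zero solution. *)
Definition flex_free z P1 P2 P3 U1 U2 U3 := forall w l,
  dot (pow_vec k (z - P1)) (w - l *: U1) = 0 ->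
  dot (pow_vec k (z - P2)) (w - l *: U2) = 0 ->
  dot (pow_vec k (z - P3)) (w - l *: U3) = 0 -> w = 0 /\ l = 0.

Lemma two_rows_indep P1 P2 (N : seq R) : P1 != P2 ->
  exists2 z, avoids z N & forall w,
  dot (pow_vec k (z - P1)) w = 0 -> dot (pow_vec k (z - P2)) w = 0 -> w = 0.
Proof.
move=> /row2_pair_neq P12.
(* Only the determinant is wanted here; (1, 0) is an arbitrary nonzero pair. *)
have [|x [y [xN yN D _]]] := spow_rows_neq0 k0 0 0 N P12 (al := 1) (be := 0).
  by apply/eqP => -[/eqP]; rewrite oner_eq0.
exists (mkrow x y); first exact: avoids_mkrow.
move=> w; rewrite !dot_pow_vec mkrow0 mkrow1.
set a1 := spow _ (x - P1 0 0) in D *; set b1 := spow _ (y - P1 0 1) in D *.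
set a2 := spow _ (x - P2 0 0) in D *; set b2 := spow _ (y - P2 0 1) in D *.
move=> h1 h2; apply: row2_eq; rewrite mxE; apply: (mulfI D).
  have -> : (a1 * b2 - a2 * b1) * w 0 0 = b2 * (a1 * w 0 0 + b1 * w 0 1) -
    b1 * (a2 * w 0 0 + b2 * w 0 1) by ring.
  by rewrite h1 h2; ring.
have -> : (a1 * b2 - a2 * b1) * w 0 1 = a1 * (a2 * w 0 0 + b2 * w 0 1) -
  a2 * (a1 * w 0 0 + b1 * w 0 1) by ring.
by rewrite h1 h2; ring.
Qed.

(** Cramer's rule for the 3 x 3 system in the two coordinates of [w] and in [l]. *)
Lemma flex_free_of_det z P1 P2 P3 U1 U2 U3 :
  flex_det (spow k (z 0 0 - P1 0 0)) (spow k (z 0 0 - P2 0 0))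
    (spow k (z 0 0 - P3 0 0)) (spow k (z 0 1 - P1 0 1))
    (spow k (z 0 1 - P2 0 1)) (spow k (z 0 1 - P3 0 1))
    (U1 0 0) (U2 0 0) (U3 0 0) (U1 0 1) (U2 0 1) (U3 0 1) != 0 ->
  flex_free z P1 P2 P3 U1 U2 U3.
Proof.
move=> D w l; rewrite !dot_pow_vec !mxE.
set a1 := spow _ (_ - P1 0 0) in D *; set b1 := spow _ (_ - P1 0 1) in D *.
set a2 := spow _ (_ - P2 0 0) in D *; set b2 := spow _ (_ - P2 0 1) in D *.
set a3 := spow _ (_ - P3 0 0) in D *; set b3 := spow _ (_ - P3 0 1) in D *.
set c1 := U1 0 0 in D *; set d1 := U1 0 1 in D *.
set c2 := U2 0 0 in D *; set d2 := U2 0 1 in D *.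
set c3 := U3 0 0 in D *; set d3 := U3 0 1 in D *.
set d := flex_det _ _ _ _ _ _ _ _ _ _ _ _ in D.
set h1 := (X in X = 0 -> _); set h2 := (X in _ -> X = 0 -> _).
set h3 := (X in _ -> _ -> X = 0 -> _).
have [d1E d2E d3E] : [/\ d * l = h3 * (a2 * b1 - a1 * b2)
      + h2 * (a1 * b3 - a3 * b1) + h1 * (a3 * b2 - a2 * b3),
    d * w 0 0 = h1 * (b2 * (a3 * c3 + b3 * d3) - b3 * (a2 * c2 + b2 * d2))
      + h2 * (b3 * (a1 * c1 + b1 * d1) - b1 * (a3 * c3 + b3 * d3))
      + h3 * (b1 * (a2 * c2 + b2 * d2) - b2 * (a1 * c1 + b1 * d1)) &
    d * w 0 1 = - h1 * (a2 * (a3 * c3 + b3 * d3) - a3 * (a2 * c2 + b2 * d2))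
      - h2 * (a3 * (a1 * c1 + b1 * d1) - a1 * (a3 * c3 + b3 * d3))
      - h3 * (a1 * (a2 * c2 + b2 * d2) - a2 * (a1 * c1 + b1 * d1))].
  by rewrite /d /h1 /h2 /h3 /flex_det; split; ring.
move=> e1 e2 e3; rewrite e1 e2 e3 in d1E d2E d3E.
split; last by apply: (mulfI D); rewrite d1E; ring.
by apply: row2_eq; rewrite mxE; apply: (mulfI D); rewrite ?d2E ?d3E; ring.
Qed.

(** When the first two velocities agree, the determinant factors into the 2 x 2 determinant of the
    first two rows and the third row applied to [U3 - U1]. *)
Lemma exists_flex_free_repeated P1 P2 P3 U1 U3 (N : seq R) :
  P1 != P2 -> U1 != U3 -> exists2 z, avoids z N & flex_free z P1 P2 P3 U1 U1 U3.
Proof.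
move=> /row2_pair_neq P12 /row2_pair_neq U13.
have [|x [y [xN yN D1 D2]]] := spow_rows_neq0 k0 (P3 0 0) (P3 0 1) N P12
  (al := U3 0 0 - U1 0 0) (be := U3 0 1 - U1 0 1).
  apply: contra U13 => /eqP[/eqP + /eqP]; rewrite !subr_eq0 => /eqP -> /eqP ->.
  by rewrite eqxx.
exists (mkrow x y); first exact: avoids_mkrow.
apply: flex_free_of_det; rewrite mkrow0 mkrow1.
have := mulf_neq0 D1 D2; apply: contra => /eqP H; rewrite -H /flex_det.
by apply/eqP; ring.
Qed.

(** The second alternative serves two edges to the same neighbour: their ends differ by a lattice
    vector, which may have a zero coordinate. *)
Definition distinct_at P P' U U' :=
  (forall i, P 0 i != P' 0 i) \/ (P != P' /\ U = U').

(** A pair with equal velocities is rotated into first position and handled by the factored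
    determinant; otherwise all coordinates are pairwise distinct and the growth argument applies. *)
Lemma exists_flex_free P1 P2 P3 U1 U2 U3 (N : seq R) :
  distinct_at P1 P2 U1 U2 -> distinct_at P2 P3 U2 U3 ->
  distinct_at P3 P1 U3 U1 -> ~ (U1 = U2 /\ U2 = U3) ->
  exists2 z, avoids z N & flex_free z P1 P2 P3 U1 U2 U3.
Proof.
move=> h12 h23 h31 hU.
case: h12 => [h12|[P12 U12]]; last first.
  rewrite -U12 in hU *; apply: exists_flex_free_repeated => //.
  by apply/eqP => e; apply: hU.
case: h23 => [h23|[P23 U23]]; last first.
  have [|z zN H] := @exists_flex_free_repeated P2 P3 P1 U2 U1 N P23.
    by apply/eqP => e; apply: hU; rewrite -e.
  by rewrite -U23; exists z => // w l e1 e2 e3; apply: H.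
case: h31 => [h31|[P31 U31]]; last first.
  have [|z zN H] := @exists_flex_free_repeated P3 P1 P2 U3 U2 N P31.
    by apply/eqP => e; apply: hU; rewrite -e -U31.
  by rewrite -U31; exists z => // w l e1 e2 e3; apply: H.
have [|x [y [xN yN D]]] := flex_det_neq0 k0 k1 N (h12 0) (h23 0) (h31 0)
  (h12 1) (h23 1) (h31 1) (al1 := U1 0 0) (al2 := U2 0 0) (al3 := U3 0 0)
  (be1 := U1 0 1) (be2 := U2 0 1) (be3 := U3 0 1).
  by move=> [e1 e2 e3 e4]; apply: hU; split; apply: row2_eq.
exists (mkrow x y); first exact: avoids_mkrow.
by apply: flex_free_of_det; rewrite mkrow0 mkrow1.
Qed.

End Rows.

(** * Tight gain graphs *)

Section EdgeLists.
Variables (V : finType).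

(** Edges are bare triples over a fixed [V], so that the induction shrinks a vertex set and edits a
    list instead of building new multigraphs. *)
Definition gain_edge : Type := (V * V * Z2)%type.
HB.instance Definition _ := Choice.on gain_edge.

Implicit Types (e : gain_edge) (E H : seq gain_edge) (A X Y : {set V}).

Definition reverse e : gain_edge := (e.1.2, e.1.1, - e.2).

Definition inside X e := (e.1.1 \in X) && (e.1.2 \in X).

(** The [uniq] clause says that no two edges agree up to reversal and that no edge is its own
    reversal. Sparsity is stated for induced subgraphs, which have the most edges, and [+ 2] avoids
    truncated subtraction. *)
Definition tight_on A E := [/\ uniq (E ++ map reverse E), all (inside A) E,
  (size E + 2 = 2 * #|A|)%N &
  forall X, X \subset A -> (0 < #|X|)%N -> (count (inside X) E + 2 <= 2 * #|X|)%N].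

Lemma reverseK : involutive reverse.
Proof. by case=> [[a b] g]; rewrite /reverse /= opprK. Qed.

Lemma inside_reverse X e : inside X (reverse e) = inside X e.
Proof. by rewrite /inside andbC. Qed.

Definition orient v e := if e.1.1 == v then e else reverse e.

Lemma inside_orient X v e : inside X (orient v e) = inside X e.
Proof. by rewrite /orient; case: ifP; rewrite ?inside_reverse. Qed.

Lemma perm_orient v E :
  perm_eq (map (orient v) E ++ map reverse (map (orient v) E))
          (E ++ map reverse E).
Proof.
apply/permP => a; rewrite !count_cat !count_map.
elim: E => //= e E IH; rewrite addnACA [RHS]addnACA IH; congr (_ + _)%N.
by rewrite /orient; case: ifP => // _; rewrite reverseK addnC.
Qed.

Lemma tight_on_orient v A E : tight_on A E -> tight_on A (map (orient v) E).
Proof.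
move=> [E_uniq EA Esz Esp]; split.
- by rewrite (perm_uniq (perm_orient v E)).
- by rewrite all_map; apply: sub_all EA => e; rewrite /= inside_orient.
- by rewrite size_map.
- move=> X XA X0; rewrite count_map -(eq_count (a1 := inside X)); first exact: Esp.
  by move=> e; rewrite /= inside_orient.
Qed.

Lemma tight_on_perm A E E' : perm_eq E E' -> tight_on A E -> tight_on A E'.
Proof.
move=> p [E_uniq EA Esz Esp]; split.
- by rewrite -(perm_uniq (perm_cat p (perm_map reverse p))).
- by rewrite -(perm_all _ p).
- by rewrite -(perm_size p).
- by move=> X; rewrite -(permP p); exact: Esp.
Qed.

Definition incident v e := (e.1.1 == v) || (e.1.2 == v).

(** Handshake count: the degrees sum to at most [2 * size E], which is 4 less than [4 * #|A|]. *)
Lemma exists_low_degree A E : tight_on A E ->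
  exists2 v, v \in A & (count (incident v) E <= 3)%N.
Proof.
move=> [_ _ Esz _].
have [[v vA d3]|H] := EM (exists2 v, v \in A & (count (incident v) E <= 3)%N).
  by exists v.
have : (\sum_(v in A) 4 <= \sum_(v in A) count (incident v) E)%N.
  apply: leq_sum => v vA; rewrite ltnNge; apply/negP => d3; apply: H.
  by exists v.
have : (\sum_(v in A) count (incident v) E <= 2 * size E)%N.
  clear; elim: E => [|e E IH] /=; first by rewrite big1.
  rewrite big_split /= mulnS leq_add //.
  apply: (@leq_trans (\sum_(v in A) ((v == e.1.1) + (v == e.1.2)))%N).
    apply: leq_sum => v _; rewrite /incident [e.1.1 == v]eq_sym [e.1.2 == v]eq_sym.
    by case: (v == _); case: (v == _).
  have one a : (\sum_(v in A) (v == a) <= 1)%N.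
    rewrite (eq_bigr (fun v => if v == a then 1 else 0)%N); last first.
      by move=> v _; case: eqP.
    rewrite -big_mkcondr /= sum1_card -(card1 a) subset_leq_card //.
    by apply/fintype.subsetP => v; rewrite unfold_in => /andP[].
  by rewrite big_split /= (leq_add (one _) (one _)).
rewrite sum_nat_const; lia.
Qed.

End EdgeLists.

(** * Splitting a tight graph at a vertex of low degree *)

Section Reductions.
Variables (V : finType).
Implicit Types (e : gain_edge V) (E F H : seq (gain_edge V)).
Implicit Types (A X Y : {set V}) (v a b : V).

Definition from_vertex v A e := (e.1.1 == v) && (e.1.2 \in A).

Lemma inside_setD1 A v e :
  inside (A :\ v) e = ~~ incident v e && inside A e.
Proof. by rewrite /inside /incident !in_setD1 negb_or andbACA. Qed.

Lemma inside_sub X Y e : X \subset Y -> inside X e -> inside Y e.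
Proof. by move=> /fintype.subsetP s /andP[/s h1 /s h2]; rewrite /inside h1. Qed.

(** Sparsity on a singleton leaves room for no edge. *)
Lemma tight_on_loopless A E e : tight_on A E -> e \in E -> e.1.1 != e.1.2.
Proof.
move=> [_ EA _ Esp] eE; apply/eqP => ee.
have := Esp [set e.1.1]; rewrite cards1 finset.sub1set.
have /andP[-> _] := allP EA _ eE => /(_ isT isT).
have : has (inside [set e.1.1]) E.
  by apply/hasP; exists e => //; rewrite /inside -ee !inE eqxx.
rewrite has_count; lia.
Qed.

Lemma tight_on_low_degree_vertex A E : tight_on A E -> (1 < #|A|)%N ->
  exists v F H, [/\ v \in A, perm_eq (map (orient v) E) (F ++ H),
    all (from_vertex v (A :\ v)) F, all (inside (A :\ v)) H &
    size F = 2 \/ size F = 3].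
Proof.
move=> tE A1; have [v vA d3] := exists_low_degree tE.
pose E1 := map (orient v) E; have tE1 : tight_on A E1 by exact: tight_on_orient.
pose F := [seq e <- E1 | e.1.1 == v].
pose H := [seq e <- E1 | predC (fun e => e.1.1 == v) e].
have pE : perm_eq E1 (F ++ H) by rewrite perm_sym perm_filterC.
have E1A e : e \in E1 -> inside A e by case: tE1 => _ /allP + _ _ => /[apply].
have E1v e : e \in E1 -> e.1.1 != v -> e.1.2 != v.
  move=> /mapP[e' e'E ->]; rewrite /orient; case: ifP => [->//|h _].
  by rewrite /= h.
have HA : all (inside (A :\ v)) H.
  apply/allP => e; rewrite mem_filter /= => /andP[ev eE].
  by rewrite inside_setD1 E1A // andbT /incident negb_or ev E1v.
have FA : all (from_vertex v (A :\ v)) F.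
  apply/allP => e; rewrite mem_filter => /andP[ev eE].
  have /andP[_ h] := E1A _ eE.
  rewrite /from_vertex ev in_setD1 h andbT -(eqP ev) eq_sym.
  exact: (tight_on_loopless tE1).
exists v, F, H; split=> //.
have FE : size F = count (incident v) E.
  rewrite size_filter count_map; apply: eq_in_count => e eE.
  by rewrite /= /orient /incident; case ev: (e.1.1 == v) => /=; rewrite ?ev.
have sA : #|A| = #|A :\ v|.+1 by rewrite (cardsD1 v) vA.
(* Sparsity on [A :\ v], nonempty since [1 < #|A|], bounds [H] by two edges fewer than the total. *)
have : (2 <= size F)%N.
  have [_ _ E1sz E1sp] := tE1.
  have := E1sp (A :\ v); rewrite subD1set -ltnS -sA => /(_ isT A1).
  have /eqP HA' : count (inside (A :\ v)) H == size H by rewrite -all_count.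
  have : (size H <= count (inside (A :\ v)) E1)%N.
    by rewrite (permP pE) count_cat HA' leq_addl.
  by move: E1sz; rewrite (perm_size pE) size_cat sA; clear;
  move: (size F) (size H) (count _ E1) #|A :\ v| => f h c n; lia.
rewrite FE; move: (count _ _) d3 => d; clear; lia.
Qed.

End Reductions.

(** * Deleting a vertex of degree two or three *)

Section TightReductions.
Variables (V : finType).
Implicit Types (e : gain_edge V) (E F H : seq (gain_edge V)).
Implicit Types (A X Y : {set V}) (v a b : V).

Lemma count_all_size (T : Type) (p : pred T) (s : seq T) :
  all p s -> count p s = size s.
Proof. by rewrite all_count => /eqP. Qed.

Lemma tight_on_remove2 A v F H : v \in A -> tight_on A (F ++ H) ->
  size F = 2 -> all (inside (A :\ v)) H -> tight_on (A :\ v) H.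
Proof.
move=> vA [uFH _ FHsz FHsp] F2 HA; split=> //.
- by apply: subseq_uniq uFH; rewrite cat_subseq ?map_subseq // suffix_subseq.
- by move: FHsz; rewrite size_cat F2 (cardsD1 v A) vA /=; lia.
- move=> X XA X0; apply: leq_trans (FHsp X _ X0).
    by rewrite count_cat leq_add2r leq_addl.
  by apply: fintype.subset_trans XA _; rewrite subD1set.
Qed.

Definition tight_set H X := (count (inside X) H + 2 == 2 * #|X|)%N.

(** Supermodularity, checked edge by edge; it makes the union of two intersecting tight sets
    tight. *)
Lemma count_inside_setUI H X Y :
  (count (inside X) H + count (inside Y) H <=
   count (inside (X :|: Y)) H + count (inside (X :&: Y)) H)%N.
Proof.
elim: H => //= e H IH.
suff : (inside X e + inside Y e <= inside (X :|: Y) e + inside (X :&: Y) e)%N.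
  by move: IH; lia.
by rewrite /inside !inE; do 4!case: (_ \in _).
Qed.

Lemma fresh_gain (s : seq Z2) :
  exists g : Z2, forall h : Z2, h \in s -> h != g /\ h != - g.
Proof.
(* [n] exceeds the absolute value of every first coordinate in [s], so (n, 0) and its opposite are
   both new. *)
pose n := (\sum_(h <- s) `|h.1|%N).+1.
exists (n%:Z, 0) => h hs.
have hn : (`|h.1| < n)%N.
  by rewrite /n ltnS (perm_big _ (perm_to_rem hs)) big_cons leq_addr.
by split; apply/eqP => e; move: hn; rewrite e /= ?abszN ?absz_nat ltnn.
Qed.

(** A set containing both ends is not tight, so it has room for one more edge; a fresh gain keeps
    the edges distinct up to reversal. *)
Lemma tight_on_add_edge A H a b : a != b -> a \in A -> b \in A ->
  uniq (H ++ map (@reverse V) H) -> all (inside A) H ->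
  (size H + 3 = 2 * #|A|)%N ->
  (forall X, X \subset A -> (0 < #|X|)%N ->
    (count (inside X) H + 2 <= 2 * #|X|)%N) ->
  (forall X, X \subset A -> a \in X -> b \in X -> ~~ tight_set H X) ->
  exists g, tight_on A ((a, b, g) :: H).
Proof.
move=> ab aA bA uH HA Hsz Hsp Hab.
have [g gP] := fresh_gain (map snd H).
exists g; split.
- rewrite (perm_uniq (s2 := (a, b, g) :: (b, a, - g) :: (H ++ map (@reverse V) H))).
    have gH c d : ((c, d, g) \notin H ++ map (@reverse V) H) &&
        ((c, d, - g) \notin H ++ map (@reverse V) H).
      rewrite !mem_cat !negb_or -!andbA; apply/and4P; split; apply/negP.
      + by move=> /(map_f snd) /gP []; rewrite eqxx.
      + move=> /mapP[e /(map_f snd) /gP [_ h2]] /(congr1 snd) /= e2.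
        by rewrite e2 opprK eqxx in h2.
      + by move=> /(map_f snd) /gP []; rewrite eqxx.
      + move=> /mapP[e /(map_f snd) /gP [h1 _]] /(congr1 snd) /oppr_inj e2.
        by rewrite e2 eqxx in h1.
    rewrite /= uH inE negb_or; have /andP[-> _] := gH a b.
    have /andP[_ ->] := gH b a; rewrite !andbT.
    by apply: contra ab => /eqP[->].
  by rewrite /= perm_cons perm_catC /= perm_cons perm_catC.
- by rewrite /= HA /inside /= aA bA.
- by rewrite /=; move: Hsz; lia.
- move=> X XA X0 /=; have := Hsp X XA X0.
  rewrite /inside /=; case: (boolP (a \in X)) => //= aX.
  case: (boolP (b \in X)) => //= bX.
  have := Hab X XA aX bX; rewrite /tight_set.
  move: (count _ H) #|X| => c n; clear; lia.
Qed.

(** If one tight set contained the first two neighbours and another the last two, they would meet in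
    the second neighbour, and their union would be a tight set containing all three. *)
Lemma tight_on_remove3 A v e1 e2 e3 H : v \in A ->
  tight_on A ([:: e1; e2; e3] ++ H) ->
  all (from_vertex v (A :\ v)) [:: e1; e2; e3] -> all (inside (A :\ v)) H ->
  exists a b g, [/\ a != b, (a, b) = (e1.1.2, e2.1.2) \/ (a, b) = (e2.1.2, e3.1.2)
    & tight_on (A :\ v) ((a, b, g) :: H)].
Proof.
move=> vA [uE _ Esz Esp] /= /and4P[f1 f2 f3 _] HA.
have /andP[/eqP s1 t1] := f1; have /andP[/eqP s2 t2] := f2.
have /andP[/eqP s3 t3] := f3.
have sA : #|A| = #|A :\ v|.+1 by rewrite (cardsD1 v) vA.
have sub X : X \subset A :\ v -> X \subset A.
  by move=> XA; apply: fintype.subset_trans XA _; rewrite subD1set.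
have uH : uniq (H ++ map (@reverse V) H).
  apply: subseq_uniq uE; rewrite cat_subseq ?map_subseq //;
  exact: (suffix_subseq [:: e1; e2; e3] H).
have Hsz : (size H + 3 = 2 * #|A :\ v|)%N 
  by move: Esz; rewrite sA size_cat; move: (size H) #|A :\ v| => h n /=; clear; lia.
have Hsp X : X \subset A :\ v -> (0 < #|X|)%N ->
    (count (inside X) H + 2 <= 2 * #|X|)%N.
  move=> XA X0; apply: leq_trans (Esp X (sub _ XA) X0).
  by rewrite count_cat leq_add2r leq_addl.
(* Adding [v] and its three edges to such a tight set would give [2 * #|X| + 1] edges on [#|X| + 1]
   vertices, one too many. *)
have no_triple X : X \subset A :\ v -> e1.1.2 \in X -> e2.1.2 \in X ->
    e3.1.2 \in X -> ~~ tight_set H X.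
  move=> XA h1 h2 h3; apply/negP => /eqP tX.
  have vX : v \notin X.
    by apply/negP => /(fintype.subsetP XA); rewrite !inE eqxx.
  have := Esp (v |: X); rewrite cardsU1 vX finset.subUset finset.sub1set vA sub //.
  move=> /(_ isT isT); rewrite count_cat count_all_size; last first.
    by rewrite /= /inside !inE s1 s2 s3 h1 h2 h3 eqxx !orbT.
  have : (count (inside X) H <= count (inside (v |: X)) H)%N.
    by apply: sub_count => e; apply: inside_sub; exact: finset.subsetUr.
  move: tX; move: (count _ _) (count _ _) #|X| => c c' n /=; clear; lia.
have [[X [XA X1 X2 tX]]|H12] :=
    EM (exists X, [/\ X \subset A :\ v, e1.1.2 \in X, e2.1.2 \in X & tight_set H X]);
  last first.
  have h12 X : X \subset A :\ v -> e1.1.2 \in X -> e2.1.2 \in X -> ~~ tight_set H X.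
    by move=> XA X1 X2; apply/negP => tX; apply: H12; exists X.
  (* A singleton spans no edge and is therefore tight, so coinciding neighbours would contradict
     [h12]. *)
  have ne : e1.1.2 != e2.1.2.
    apply/eqP => e12; have := h12 [set e1.1.2].
    rewrite finset.sub1set t1 !inE e12 eqxx => /(_ isT isT isT).
    have := Hsp [set e2.1.2]; rewrite finset.sub1set t2 cards1 => /(_ isT isT).
    by rewrite /tight_set cards1; move: (count _ _) => c; clear; lia.
  have [g tg] := tight_on_add_edge ne t1 t2 uH HA Hsz Hsp h12.
  by exists e1.1.2, e2.1.2, g; split => //; left.
have h23 Y : Y \subset A :\ v -> e2.1.2 \in Y -> e3.1.2 \in Y -> ~~ tight_set H Y.
  move=> YA Y2 Y3; apply/negP => tY.
  have XYA : X :|: Y \subset A :\ v by rewrite finset.subUset XA YA.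
  have XYI : (0 < #|X :&: Y|)%N by apply/card_gt0P; exists e2.1.2; rewrite inE X2 Y2.
  have XYU : (0 < #|X :|: Y|)%N by apply/card_gt0P; exists e2.1.2; rewrite inE X2.
  have := no_triple _ XYA; rewrite !inE X1 X2 Y3 orbT => /(_ isT isT isT).
  move: tX tY; rewrite /tight_set.
  have := count_inside_setUI H X Y; have := cardsUI X Y.
  have := Hsp _ XYA XYU.
  have IA : X :&: Y \subset A :\ v.
    by apply: fintype.subset_trans XA; exact: finset.subsetIl.
  have := Hsp _ IA XYI.
  move: #|X| #|Y| #|X :|: Y| #|X :&: Y| => x y u i.
  move: (count _ _) (count _ _) (count _ _) (count _ _) => cu ci cx cy; clear; lia.
have ne : e2.1.2 != e3.1.2.
  apply/eqP => e23; have := h23 [set e2.1.2].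
  rewrite finset.sub1set t2 !inE -e23 eqxx => /(_ isT isT isT).
  have := Hsp [set e2.1.2]; rewrite finset.sub1set t2 cards1 => /(_ isT isT).
  by rewrite /tight_set cards1; move: (count _ _) => c; clear; lia.
have [g tg] := tight_on_add_edge ne t2 t3 uH HA Hsz Hsp h23.
by exists e2.1.2, e3.1.2, g; split => //; right.
Qed.

End TightReductions.

(** * Rigid placements of tight gain graphs *)

Section RigidPlacements.
Variables (R : realType) (k : R).
Hypotheses (k0 : 0 < k) (k1 : k != 1).
Variable L : Z2 -> 'rV[R]_2.
Hypotheses (LN : forall g, L (- g) = - L g) (Linj : injective L).
Variable V : finType.
Implicit Types (e : gain_edge V) (E F H : seq (gain_edge V)) (N : seq R).
Implicit Types (A : {set V}) (v : V) (p u : V -> 'rV[R]_2) (z : 'rV[R]_2).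

Definition edge_vector p e := p e.1.1 - p e.1.2 - L e.2.

Definition motion_of p E u := forall e, e \in E ->
  dot (pow_vec k (edge_vector p e)) (u e.1.1 - u e.1.2) = 0.

Definition rigid_on A p E := forall u, motion_of p E u ->
  {in A &, forall x y, u x = u y}.

(** Genericity carried through the induction: with suitable lattice offsets in [N], the far ends of
    edges to different neighbours differ in each coordinate. *)
Definition separated A p N := forall x y, x \in A -> y \in A -> x != y ->
  avoids (p x - p y) N.

Lemma motion_of_cat p E E' u : motion_of p (E ++ E') u ->
  motion_of p E u /\ motion_of p E' u.
Proof.
by move=> Hu; split=> e eE; apply: Hu; rewrite mem_cat eE ?orbT.
Qed.

Lemma separated_cat A p N1 N2 : separated A p (N1 ++ N2) ->
  separated A p N1 /\ separated A p N2.
Proof.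
by move=> sp; split=> x y xA yA xy i; have := sp x y xA yA xy i;
  rewrite mem_cat negb_or => /andP[].
Qed.

Lemma motion_of_orient v p E u :
  motion_of p E u -> motion_of p (map (orient v) E) u.
Proof.
move=> Hu _ /mapP[e eE ->]; rewrite -[RHS](Hu e eE) /orient; case: ifP => // _.
have -> : edge_vector p (reverse e) = - edge_vector p e.
  by rewrite /edge_vector /= LN !opprD !opprK [- _ + _]addrC.
by rewrite /= -(opprB (u e.1.1)) pow_vecN dotNl dotNr opprK.
Qed.

Definition extend_at p v z : V -> 'rV[R]_2 := fun x => if x == v then z else p x.

(** Both [N] and its negatives occur because [separated] constrains the differences in both
    orders. *)
Definition forbidden p N : seq R :=
  [seq c + n | c <- [seq p y 0 i | y <- enum V, i <- enum 'I_2],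
               n <- N ++ map -%R N].

Lemma separated_extend A p v z N : separated (A :\ v) p N ->
  avoids z (forbidden p N) -> separated A (extend_at p v z) N.
Proof.
move=> sp zN x y xA yA xy i; rewrite /extend_at.
have bad w n : n \in N ++ map -%R N -> z 0 i != p w 0 i + n.
  move=> nN; apply: contra (zN i) => /eqP ->.
  by apply: allpairs_f => //; apply: allpairs_f; rewrite mem_enum.
case: (eqVneq x v) (eqVneq y v) => [xv|xv] [yv|yv].
- by rewrite xv yv eqxx in xy.
- rewrite !mxE; apply/negP => h; have := bad y (z 0 i - p y 0 i).
  by rewrite mem_cat h [p y 0 i + _]addrC subrK eqxx => /(_ isT).
- rewrite !mxE; apply/negP => h; have := bad x (- (p x 0 i - z 0 i)).
  by rewrite mem_cat map_f ?orbT // opprB [p x 0 i + _]addrC subrK eqxx => /(_ isT).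
- by apply: sp; rewrite ?in_setD1 ?xv ?yv.
Qed.

Lemma motion_of_extend A p v z H u : all (inside (A :\ v)) H ->
  motion_of (extend_at p v z) H u -> motion_of p H u.
Proof.
move=> /allP HA Hu e eH; have := Hu e eH.
have /andP[] := HA e eH; rewrite !in_setD1 => /andP[e1 _] /andP[e2 _].
by rewrite /edge_vector /extend_at (negPf e1) (negPf e2).
Qed.

(** Where the far end of [e] sits in the derived framework when its source is taken in the identity
    copy. *)
Definition anchor p e := p e.1.2 + L e.2.

Lemma edge_vector_extend A p v z e : from_vertex v (A :\ v) e ->
  edge_vector (extend_at p v z) e = z - anchor p e.
Proof.
move=> /andP[/eqP e1]; rewrite in_setD1 => /andP[e2 _].
by rewrite /edge_vector /extend_at e1 eqxx (negPf e2) /anchor opprD addrA.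
Qed.

Definition offsets F : seq R :=
  [seq (d : 'rV[R]_2) 0 i | d <- [seq L e.2 - L e'.2 | e <- F, e' <- F],
                            i <- enum 'I_2].

(** Edges to one neighbour have different gains, hence different anchors as [L] is injective; for
    different neighbours, equal coordinates would put an offset among the differences of [p]. *)
Lemma distinct_anchors A p v F e e' u0 : separated (A :\ v) p (offsets F) ->
  e \in F -> e' \in F -> from_vertex v (A :\ v) e -> from_vertex v (A :\ v) e' ->
  e != e' -> distinct_at (anchor p e) (anchor p e') (u0 e.1.2) (u0 e'.1.2 : 'rV[R]_2).
Proof.
move=> sp eF e'F /andP[/eqP e1 e2] /andP[/eqP e1' e2'] ne.
have [ee|ee] := eqVneq e.1.2 e'.1.2; [right|left].
  rewrite ee; split => //; apply: contra ne; rewrite /anchor ee.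
  move=> /eqP /addrI /Linj ge; case: e e' e1 e1' ee ge {eF e'F e2 e2'} =>
    [[a b] g] [[a' b'] g'] /= -> -> -> ->; exact: eqxx.
move=> i; have := sp _ _ e2 e2' ee i; apply: contra; rewrite /anchor !mxE => h.
have -> : p e.1.2 0 i - p e'.1.2 0 i = (L e'.2 - L e.2) 0 i.
  by rewrite !mxE; move: h => /eqP; lra.
by apply: allpairs_f; [exact: allpairs_f|rewrite mem_enum].
Qed.

Lemma rigid_extend2 A p v e1 e2 H N :
  all (from_vertex v (A :\ v)) [:: e1; e2] -> e1 != e2 ->
  all (inside (A :\ v)) H ->
  separated (A :\ v) p (offsets [:: e1; e2] ++ N) -> rigid_on (A :\ v) p H ->
  exists2 p', separated A p' N & rigid_on A p' ([:: e1; e2] ++ H).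
Proof.
move=> /and3P[f1 f2 _] e12 HA sp rp.
have [sO sN] := separated_cat sp.
have P12 : anchor p e1 != anchor p e2.
  have [||h|[]//] := distinct_anchors (fun=> 0) sO _ _ f1 f2 e12.
  - by rewrite inE eqxx.
  - by rewrite !inE eqxx orbT.
  - by apply: contra (h 0) => /eqP ->.
have [z zN zP] := two_rows_indep k0 (forbidden p N) P12.
exists (extend_at p v z); first exact: separated_extend.
move=> u Hu.
have [HuF HuH] := motion_of_cat Hu; have Hu' := motion_of_extend HA HuH.
have [c uc] : exists c, forall x, x \in A :\ v -> u x = c.
  by exists (u e1.1.2) => x xA; apply: rp => //; case/andP: f1.
have uv : u v = c.
  have row e : e \in [:: e1; e2] -> from_vertex v (A :\ v) e ->
      dot (pow_vec k (z - anchor p e)) (u v - c) = 0.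
    move=> eF fe; have := HuF e eF; rewrite (edge_vector_extend _ _ fe).
    by case/andP: fe => /eqP -> /uc ->.
  apply/eqP; rewrite -subr_eq0; apply/eqP; apply: zP; apply: row => //.
  - by rewrite inE eqxx.
  - by rewrite !inE eqxx orbT.
have uA x : x \in A -> u x = c.
  by move=> xA; have [->//|xv] := eqVneq x v; apply: uc; rewrite in_setD1 xv.
by move=> x y /uA -> /uA ->.
Qed.

(** Deleting one row adds at most one dimension of motions: the value of a motion on that row
    determines the multiple [l]. *)
Lemma one_flex A p a b g H : a != b -> rigid_on A p ((a, b, g) :: H) ->
  exists2 u0, u0 a != u0 b & forall u, motion_of p H u -> exists l,
    {in A &, forall x y, u x - u y = l *: (u0 x - u0 y)}.
Proof.
move=> ab rp.
pose r := pow_vec k (edge_vector p (a, b, g)).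
have [[u0 [Hu0 t0]]|Hno] :=
    EM (exists u0, motion_of p H u0 /\ dot r (u0 a - u0 b) != 0).
  exists u0.
    apply: contra t0 => /eqP ->; apply/eqP; rewrite subrr dotE !mxE; ring.
  move=> u Hu; exists (dot r (u a - u b) / dot r (u0 a - u0 b)).
  set l := _ / _.
  have : motion_of p ((a, b, g) :: H) (fun x => u x - l *: u0 x).
    have comb x y : u x - l *: u0 x - (u y - l *: u0 y) =
        (u x - u y) + - (l *: (u0 x - u0 y)).
      by apply/rowP => i; rewrite !mxE; ring.
    move=> e; rewrite inE => /predU1P[->|eH]; rewrite comb dotDr dotNr dotZr /=.
      by rewrite -/r divfK // subrr.
    by rewrite Hu // Hu0 // mulr0 subr0.
  move=> /rp h x y xA yA; have := h x y xA yA => /rowP h'.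
  by apply/rowP => i; have := h' i; rewrite !mxE; lra.
(* Here [H] alone is already rigid, so any [u0] that separates [a] from [b] serves, with [l = 0]. *)
exists (fun x => if x == a then delta_mx 0 0 else 0).
  rewrite eqxx [b == a]eq_sym (negPf ab); apply/eqP => /rowP /(_ 0); rewrite !mxE /=.
  by apply/eqP; rewrite oner_eq0.
move=> u Hu; exists 0 => x y xA yA; rewrite scale0r; apply/eqP; rewrite subr_eq0.
apply/eqP; apply: (rp u) => // e; rewrite inE => /predU1P[->|]; last exact: Hu.
by apply/eqP; rewrite -[_ == _]negbK; apply/negP => t; apply: Hno; exists u.
Qed.

(** On the old vertices a motion is a translation [c] plus [l] times the flex. Since [u0 a != u0 b],
    the flex is not constant on the neighbours of [v], and a [flex_free] position forces [l = 0] and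
    [u v = c]. *)
Lemma rigid_extend3 A p v e1 e2 e3 a b g H N :
  all (from_vertex v (A :\ v)) [:: e1; e2; e3] ->
  e1 != e2 -> e2 != e3 -> e3 != e1 -> all (inside (A :\ v)) H -> a != b ->
  (a, b) = (e1.1.2, e2.1.2) \/ (a, b) = (e2.1.2, e3.1.2) ->
  separated (A :\ v) p (offsets [:: e1; e2; e3] ++ N) ->
  rigid_on (A :\ v) p ((a, b, g) :: H) ->
  exists2 p', separated A p' N & rigid_on A p' ([:: e1; e2; e3] ++ H).
Proof.
move=> /and4P[f1 f2 f3 _] e12 e23 e31 HA ab abE sp rp.
have [sO sN] := separated_cat sp.
have [u0 u0ab flex] := one_flex ab rp.
have m1 : e1 \in [:: e1; e2; e3] by rewrite inE eqxx.
have m2 : e2 \in [:: e1; e2; e3] by rewrite !inE eqxx orbT.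
have m3 : e3 \in [:: e1; e2; e3] by rewrite !inE eqxx !orbT.
have u0ne : ~ (u0 e1.1.2 = u0 e2.1.2 /\ u0 e2.1.2 = u0 e3.1.2).
  move=> [h12 h23]; move: u0ab.
  by case: abE => -[-> ->]; rewrite ?h12 ?h23 eqxx.
have [z zN zP] := exists_flex_free k0 k1 (forbidden p N)
  (distinct_anchors u0 sO m1 m2 f1 f2 e12) (distinct_anchors u0 sO m2 m3 f2 f3 e23)
  (distinct_anchors u0 sO m3 m1 f3 f1 e31) u0ne.
exists (extend_at p v z); first exact: separated_extend.
move=> u Hu.
have [HuF HuH] := motion_of_cat Hu; have Hu' := motion_of_extend HA HuH.
have [l lP] := flex u Hu'.
have t1 : e1.1.2 \in A :\ v by case/andP: f1.
pose c := u e1.1.2 - l *: u0 e1.1.2.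
have uc x : x \in A :\ v -> u x = c + l *: u0 x.
  move=> xA; have := lP x e1.1.2 xA t1 => /rowP h; apply/rowP => i.
  by have := h i; rewrite !mxE; lra.
have row e : e \in [:: e1; e2; e3] -> from_vertex v (A :\ v) e ->
    dot (pow_vec k (z - anchor p e)) (u v - c - l *: u0 e.1.2) = 0.
  move=> eF fe; have := HuF e eF; rewrite (edge_vector_extend _ _ fe).
  rewrite -[u v - c - _]addrA -opprD.
  by case/andP: fe => /eqP -> /uc ->.
have [/eqP] := zP _ _ (row _ m1 f1) (row _ m2 f2) (row _ m3 f3).
rewrite subr_eq0 => /eqP uv l0.
have uA x : x \in A -> u x = c.
  move=> xA; have [->//|xv] := eqVneq x v.
  by rewrite uc ?in_setD1 ?xv // l0 scale0r addr0.
by move=> x y /uA -> /uA ->.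
Qed.

(** [N] is arbitrary so that the inductive call can also demand separation from the offsets of the
    removed edges. *)
Theorem tight_on_rigid A E N : tight_on A E ->
  exists2 p, separated A p N & rigid_on A p E.
Proof.
have [n An] := ubnP #|A|; elim: n => // n IH in A E N An *.
move=> tE; have [A1|A1] := leqP #|A| 1.
  have one x y : x \in A -> y \in A -> x = y.
    by move=> xA yA; apply: (card_le1_eqP A1).
  exists (fun=> 0); first by move=> x y xA yA; rewrite (one x y) ?eqxx.
  by move=> u _ x y xA yA; rewrite (one x y).
have [v [F [H [vA pE FA HA Fsz]]]] := tight_on_low_degree_vertex tE A1.
have tFH : tight_on A (F ++ H) by apply: tight_on_perm pE (tight_on_orient v tE).
suff [p' sp rp] : exists2 p', separated A p' N & rigid_on A p' (F ++ H).
  exists p' => // u Hu; apply: rp => e; rewrite -(perm_mem pE).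
  exact: (motion_of_orient Hu).
have Av : (#|A :\ v| < n)%N by move: An; rewrite (cardsD1 v A) vA.
have uF : uniq F by have [+ _ _ _] := tFH; rewrite -catA cat_uniq => /and3P[].
case: Fsz => Fsz.
  move: F Fsz tFH FA uF {pE} => [|e1 [|e2 []]] // Fsz tFH FA /andP[+ _].
  rewrite inE => e12; have tH := tight_on_remove2 vA tFH Fsz HA.
  have [p sp rp] := IH _ _ (offsets [:: e1; e2] ++ N) Av tH.
  exact: rigid_extend2 FA e12 HA sp rp.
move: F Fsz tFH FA uF {pE} => [|e1 [|e2 [|e3 []]]] // Fsz tFH FA /and3P[].
rewrite !inE negb_or => /andP[e12 e13] e23 _.
have [a [b [g [ab abE tH]]]] := tight_on_remove3 vA tFH FA HA.
have [p sp rp] := IH _ _ (offsets [:: e1; e2; e3] ++ N) Av tH.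
by apply: rigid_extend3 FA e12 e23 _ HA ab abE sp rp; rewrite eq_sym.
Qed.

End RigidPlacements.

(** * Row counts *)

Section LinearSystems.

(** A matrix with more rows than columns has a nonzero left kernel vector, extended here by zero
    outside [A]. *)
Lemma nonzero_solution (F : fieldType) (I J : finType) (A : {set I})
    (B : {set J}) (M : I -> J -> F) : (#|B| < #|A|)%N ->
  exists c : I -> F, [/\ exists2 i, i \in A & c i != 0,
    forall i, i \notin A -> c i = 0 &
    forall j, j \in B -> \sum_(i in A) c i * M i j = 0].
Proof.
move=> BA; pose X := \matrix_(i < #|A|, j < #|B|) M (enum_val i) (enum_val j).
have K0 : kermx X != 0.
  by rewrite kermx_eq0 /row_free neq_ltn (leq_ltn_trans (rank_leq_col X)).
pose r := nz_row (kermx X).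
have rX : r *m X = 0 by apply/sub_kermxP/nz_row_sub.
have r0 : r != 0 by rewrite nz_row_eq0.
have [i0 i0A] : exists i0, i0 \in A by apply/card_gt0P; apply: leq_trans BA.
pose c i := if i \in A then r 0 (enum_rank_in i0A i) else 0.
have cE k : c (enum_val k) = r 0 k by rewrite /c enum_valP enum_valK_in.
exists c; split.
- have /existsP[k rk] : [exists k, r 0 k != 0].
    apply: contraR r0 => /existsPn h; apply/eqP/rowP => k; rewrite mxE.
    by apply/eqP; rewrite -[_ == _]negbK; exact: h.
  by exists (enum_val k); rewrite ?cE ?enum_valP.
- by move=> i /negPf iA; rewrite /c iA.
- move=> j jB; rewrite big_enum_val /=.
  have := congr1 (fun Y : 'rV_#|B| => Y 0 (enum_rank_in jB j)) rX.
  rewrite !mxE => h; rewrite -[RHS]h; apply: eq_bigr => k _.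
  by rewrite cE mxE enum_rankK_in.
Qed.

Lemma has_dim_dependent (R : realType) (W : lmodType R) (S : set W) (n k : nat)
    (f : 'I_k -> W) : has_dim S n -> (forall j, S (f j)) -> (n < k)%N ->
  exists2 d : 'I_k -> R, (exists j, d j != 0) & \sum_j d j *: f j = 0.
Proof.
move=> [b [_ bS]] Sf nk.
have /choice [c cP] : forall j, exists c : 'I_n -> R, f j = \sum_i c i *: b i.
  by move=> j; apply/bS.
have [|d [[j _ dj] _ dP]] := @nonzero_solution R _ _ [set: 'I_k] [set: 'I_n] c.
  by rewrite !cardsT !card_ord.
exists d; first by exists j.
rewrite (eq_bigr (fun j => \sum_i (d j * c j i) *: b i)); last first.
  by move=> l _; rewrite cP scaler_sumr; apply: eq_bigr => i _; rewrite scalerA.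
rewrite exchange_big big1 // => i _; rewrite -scaler_suml.
have := dP i; rewrite finset.in_setT => /(_ isT).
by under eq_bigl do rewrite finset.in_setT; move=> ->; rewrite scale0r.
Qed.

Variables (R : realType) (V E : finType) (s t : E -> V) (r : E -> 'rV[R]_2).

(** Entry of the rigidity matrix for edge [e] and coordinate [x.2] of vertex [x.1]; the two terms
    cancel for a loop. *)
Definition incidence (x : V * 'I_2) (e : E) : R :=
  r e 0 x.2 * ((x.1 == s e)%:R - (x.1 == t e)%:R).

Lemma dot_incidence (u : V -> 'rV[R]_2) e :
  dot (r e) (u (s e) - u (t e)) = \sum_x u x.1 0 x.2 * incidence x e.
Proof.
rewrite -(pair_bigA _ (fun v i => u v 0 i * incidence (v, i) e)) /= exchange_big.
apply: eq_bigr => i _; rewrite /incidence /= !mxE.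
have delta a : \sum_v u v 0 i * (v == a)%:R = u a 0 i.
  rewrite (bigD1 a) //= eqxx mulr1 big1 ?addr0 // => v /negPf ->.
  by rewrite mulr0.
rewrite -!delta -sumrB mulr_sumr; apply: eq_bigr => v _; ring.
Qed.

(** Pinning [v0] at 0 leaves [2 * #|V| - 2] unknowns, and a nonzero solution is then no
    translation. *)
Lemma few_rows_flexible (v0 : V) (B : {set E}) : (#|B| + 2 < 2 * #|V|)%N ->
  exists u : V -> 'rV[R]_2,
    (forall e, e \in B -> dot (r e) (u (s e) - u (t e)) = 0) /\
    exists x y, u x != u y.
Proof.
move=> hB; pose A := finset.setX [set~ v0] [set: 'I_2].
have [|c [[[v i]]]] := @nonzero_solution R _ _ A B incidence.
  by rewrite cardsX cardsC1 cardsT card_ord; lia.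
rewrite !inE andbT => vv0 cv cA cB.
have Av0 j : (v0, j) \notin A by rewrite !inE eqxx.
exists (fun x => \row_j c (x, j)); split.
  move=> e /cB h; rewrite (dot_incidence (fun x => \row_j c (x, j))) -[RHS]h.
  rewrite [RHS]big_mkcond; apply: eq_bigr => -[x j] _; rewrite mxE /=.
  by case: ifP => // /negbT /cA ->; rewrite mul0r.
exists v, v0; apply/eqP => /rowP /(_ i); rewrite !mxE (cA (v0, i)) //.
exact/eqP.
Qed.

(** The rows annihilate translations, so the two columns of [v0] follow from the others and only
    [2 * #|X| - 2] equations remain. *)
Lemma many_rows_dependent (X : {set V}) (B : {set E}) :
  (forall e, e \in B -> s e \in X /\ t e \in X) -> (0 < #|X|)%N ->
  (2 * #|X| < #|B| + 2)%N ->
  exists c : E -> R, (exists2 e, e \in B & c e != 0) /\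
    forall u : V -> 'rV[R]_2,
      \sum_(e in B) c e * dot (r e) (u (s e) - u (t e)) = 0.
Proof.
move=> BX /card_gt0P[v0 v0X] hX; pose Y := finset.setX (X :\ v0) [set: 'I_2].
have [|c [cB _ cY]] := @nonzero_solution R _ _ B Y (fun e x => incidence x e).
  by move: hX; rewrite cardsX cardsT card_ord (cardsD1 v0 X) v0X; lia.
exists c; split => // u.
rewrite (eq_bigr (fun e => \sum_x (u x.1 - u v0) 0 x.2 * (c e * incidence x e)));
  last first.
  move=> e eB; have -> : u (s e) - u (t e) = (u (s e) - u v0) - (u (t e) - u v0).
    by rewrite opprB addrA subrK.
  rewrite (dot_incidence (fun x => u x - u v0)) mulr_sumr.
  by apply: eq_bigr => x _; rewrite mulrCA.
rewrite exchange_big big1 //= => -[x i] _; rewrite -mulr_sumr /=.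
have [->|xv0] := eqVneq x v0; first by rewrite subrr mxE mul0r.
have [xX|xX] := boolP (x \in X).
  by rewrite (cY (x, i)) ?mulr0 // !inE xv0 xX.
rewrite big1 ?mulr0 // => e /BX [sX tX]; rewrite /incidence /=.
have ne a : a \in X -> (x == a) = false.
  by move=> aX; apply: contraNF xX => /eqP ->.
by rewrite !ne // subrr !mulr0.
Qed.

End LinearSystems.

(** * Symmetric frameworks *)

Section Lattice.
Variables (R : realType) (w1 w2 : 'rV[R]_2).

Definition lattice_point (g : Z2) : 'rV[R]_2 := w1 *~ g.1 + w2 *~ g.2.

Lemma lattice_pointD g h :
  lattice_point (g + h) = lattice_point g + lattice_point h.
Proof. by rewrite /lattice_point !mulrzDr addrACA. Qed.

Lemma lattice_pointN g : lattice_point (- g) = - lattice_point g.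
Proof. by rewrite /lattice_point !mulrNz opprD. Qed.

Lemma lattice_point_inj : free [:: w1; w2] -> injective lattice_point.
Proof.
rewrite free_cons seq1_free => /andP[w1w2 w20].
suff ker0 g : lattice_point g = 0 -> g = 0.
  move=> g h gh; apply/eqP; rewrite -subr_eq0; apply/eqP/ker0.
  by rewrite lattice_pointD lattice_pointN gh subrr.
case: g => a b; rewrite /lattice_point /= -(scaler_int a w1) -(scaler_int b w2) => H.
have a0 : a = 0.
  apply/eqP; rewrite -(intr_eq0 R); apply: contraR w1w2 => a0.
  rewrite span_seq1; apply/vlineP; exists (- (b%:~R / a%:~R)).
  apply: (scalerI a0); rewrite scalerA mulrN mulrCA divff // mulr1 scaleNr.
  by apply/eqP; rewrite -addr_eq0 H.
move/eqP: H; rewrite a0 scale0r add0r scaler_eq0 (negPf w20) orbF intr_eq0.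
by move=> /eqP ->.
Qed.

End Lattice.

Lemma tight_card (G : multigraph) :
  tight 2 2 G -> (#|edge G| + 2 = 2 * #|vertex G|)%N.
Proof. by case=> _; move: #|edge G| #|vertex G| => a b; lia. Qed.

(** * Edge orbits, and tight gain graphs as edge lists *)

Section EdgeOrbits.
Variables (G : multigraph) (m : edge G -> Z2).
Hypothesis hm : is_gain m.

(** A common derived edge would give [e] and [f] equal gains if traversed in the same direction and
    opposite gains otherwise, which [is_gain] forbids for distinct edges. *)
Lemma edge_orbit_inj e f (x y : derived_vertex G) :
  edge_orbit m e x y -> edge_orbit m f x y -> e = f.
Proof.
case: hm => par anti _ Oe Of.
have [//|ef] := eqVneq e f.
have pairP (a b : Z2) (v w : vertex G) : (a, v) = (b, w) -> a = b /\ v = w.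
  by move=> [-> ->].
have cross (g h : Z2) : g = h + m f -> g + m e = h -> m e = - m f.
  move=> -> /eqP; rewrite -addrA -[X in _ == X]addr0 (inj_eq (addrI _)).
  by rewrite addrC addr_eq0 => /eqP.
case: Oe Of => [g [[-> ->]|[-> ->]]]
  [h [[/pairP[gE vE] /pairP[hE wE]]|[/pairP[gE vE] /pairP[hE wE]]]].
- by case: (par e f ef vE wE); move: hE; rewrite gE => /addrI.
- by case: (anti e f ef wE vE); apply: cross hE gE.
- by case: (anti e f ef wE vE); apply: cross hE gE.
- by case: (par e f ef vE wE); move: hE; rewrite gE => /addrI.
Qed.

Lemma derived_adj_minusP e (x y : derived_vertex G) :
  derived_adj_minus m e x y <-> exists2 f, f != e & edge_orbit m f x y.
Proof.
split=> [[[f Of] nOe]|[f fe Of]].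
  by exists f => //; apply/eqP => fe; apply: nOe; rewrite -fe.
split; first by exists f.
by move=> Oe; move: fe; rewrite (edge_orbit_inj Oe Of) eqxx.
Qed.

Definition gain_edge_of (e : edge G) : gain_edge (vertex G) := (src e, tgt e, m e).

Definition gain_edges := [seq gain_edge_of e | e <- enum (edge G)].

Lemma tight_on_gain_edges : tight 2 2 G -> tight_on [set: vertex G] gain_edges.
Proof.
case: hm => par anti _ tG; have [sp _] := tG.
have loopless (e : edge G) : src e != tgt e.
  apply/eqP => ee; have sub : is_subgraph [set src e] [set e].
    by move=> f; rewrite inE => /eqP ->; rewrite -ee !inE.
  by have := sp _ _ sub; rewrite !cards1 => /(_ isT).
have inj : injective gain_edge_of.
  by move=> e f [sE tE mE]; apply/eqP/negPn/negP => ef; apply: (par e f ef).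
split.
- have uE : uniq gain_edges by rewrite map_inj_uniq ?enum_uniq.
  rewrite cat_uniq (map_inj_uniq (can_inj (@reverseK _))) uE andbT /=.
  apply/hasPn => _ /mapP[_ /mapP[e _ ->] ->].
  apply/negP => /mapP[f _ [tE sE mE]].
  have [ef|ef] := eqVneq e f; first by have := loopless e; rewrite tE -ef eqxx.
  by apply: (anti e f ef); rewrite // -mE opprK.
- by apply/allP => e _; rewrite /inside !inE.
- by rewrite size_map -cardE cardsT; exact: tight_card.
- move=> X _ X0; pose EX := [set e | inside X (gain_edge_of e)].
  have -> : count (inside X) gain_edges = #|EX|.
    rewrite count_map cardE size_filter -enumT; apply: eq_count => e.
    by rewrite /= inE.
  (* [sparse] speaks only of nonempty edge sets; for empty [EX] the bound is [2 <= 2 * #|X|]. *)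
  have [E0|E1] := leqP 1 #|EX|; last first.
    move: E1 X0; case: #|EX|; case: #|X| => //= n _ _.
    by rewrite mulnS leq_addr.
  have : is_subgraph X EX by move=> e; rewrite inE => /andP[].
  by move=> /sp /(_ E0); move: #|EX| #|X| => a b; clear; lia.
Qed.

End EdgeOrbits.

(** * Reduction of symmetric motions to the quotient graph *)

Section SymmetricMotions.
Variables (R : realType) (q : R) (w1 w2 : 'rV[R]_2).
Variables (G : multigraph) (m : edge G -> Z2).
Implicit Types (p : vertex G -> 'rV[R]_2).
Implicit Types (e : edge G) (S : pred (edge G)).

Local Notation act := (lattice_act w1 w2).
Local Notation L := (lattice_point w1 w2).

Definition row p e := pow_vec (q - 1) (edge_vector L p (gain_edge_of m e)).

Definition quotient_motion p S (u : vertex G -> 'rV[R]_2) :=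
  forall e, S e -> dot (row p e) (u (src e) - u (tgt e)) = 0.

Definition quotient_rigid p S :=
  forall u, quotient_motion p S u -> forall x y, u x = u y.

Lemma lattice_actE g a : act g a = a + L g.
Proof. by []. Qed.

Lemma linear_part_lattice g a : linear_part (act g) a = a.
Proof. by rewrite /linear_part /lattice_act add0r addrK. Qed.

Lemma derived_edge_vector p e (g : Z2) :
  derived_placement act p (g, src e) - derived_placement act p (g + m e, tgt e)
  = edge_vector L p (gain_edge_of m e).
Proof.
rewrite /derived_placement !lattice_actE /edge_vector /= lattice_pointD.
by apply/rowP => i; rewrite !mxE; ring.
Qed.

(** Translations have identity linear part, so a symmetric motion is constant on vertex orbits, and
    all edges of an orbit impose the same condition. *)
Lemma sym_inf_motionP (adj : derived_vertex G -> derived_vertex G -> Prop) p S :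
  (forall x y, adj x y <-> exists2 e, S e & edge_orbit m e x y) ->
  forall u, sym_inf_motion q act adj p u <->
    (exists2 u0, quotient_motion p S u0 & u = fun x => u0 x.2).
Proof.
move=> adjE u; split=> [[Hu symu]|[u0 Hu0 ->]].
  have ug g v : u (g, v) = u (0, v).
    have := symu g (0, v); rewrite linear_part_lattice => <-.
    by rewrite /vertex_act /= addr0.
  exists (fun v => u (0, v)); last by apply/funext => -[g v]; rewrite ug.
  move=> e Se; have := Hu (0, src e) (0 + m e, tgt e).
  rewrite derived_edge_vector ug => -> //.
  by apply/adjE; exists e => //; exists 0; left.
split; last by move=> g x; rewrite linear_part_lattice.
move=> x y /adjE[e Se [g [[-> ->]|[-> ->]]]].
  by rewrite derived_edge_vector Hu0.
rewrite -[X in pow_vec _ X]opprB derived_edge_vector pow_vecN dotNl.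
by rewrite -[X in dot _ X]opprB dotNr opprK Hu0.
Qed.

Lemma sym_inf_rigidP (adj : derived_vertex G -> derived_vertex G -> Prop) p S :
  (forall x y, adj x y <-> exists2 e, S e & edge_orbit m e x y) ->
  sym_inf_rigid q act adj p <-> quotient_rigid p S.
Proof.
move=> adjE; split=> H u Hu.
  move=> x y; have [|c uc] := H (fun z => u z.2).
    by apply/(sym_inf_motionP _ adjE); exists u.
  by have := uc (0, x); have := uc (0, y) => /= -> ->.
have /(sym_inf_motionP _ adjE)[u0 /H h ->] := Hu.
have [[v _]|noV] := EM (exists v : vertex G, true).
  by exists (u0 v) => x; apply: h.
(* Without vertices every map is trivially constant. *)
by exists 0 => -[g v]; case: noV; exists v.
Qed.

Lemma derived_adjP (x y : derived_vertex G) :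
  derived_adj m x y <-> exists2 e, predT e & edge_orbit m e x y.
Proof. by split=> -[e]; exists e. Qed.

Lemma quotient_rigid_card p S (v0 : vertex G) : quotient_rigid p S ->
  (2 * #|vertex G| <= #|[set e | S e]| + 2)%N.
Proof.
move=> rp; rewrite leqNgt; apply/negP => hS.
have [u [Hu [x [y /eqP]]]] :=
  few_rows_flexible (@src G) (@tgt G) (row p) v0 hS.
by apply; apply: rp => e Se; apply: Hu; rewrite inE.
Qed.

(* Dropping an edge whose row is a combination of the others preserves the
   motions, so minimality forces the rows to be independent. *)
Lemma min_rigid_sparse p :
  (forall e, ~ quotient_rigid p (predC1 e)) -> quotient_rigid p predT ->
  sparse 2 2 G.
Proof.
move=> hmin rp X B BX B1.
have X0 : (0 < #|X|)%N.
  have /card_gt0P[e eB] := B1; apply/card_gt0P; exists (src e).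
  by case: (BX e eB).
suff : (#|B| + 2 <= 2 * #|X|)%N by lia.
rewrite leqNgt; apply/negP => hX.
have [c [[e eB ce] cP]] := many_rows_dependent (row p) BX X0 hX.
apply: (hmin e) => u Hu; apply: rp => f _.
have [->|fe] := eqVneq f e; last exact: Hu.
have := cP u; rewrite (bigD1 e) //= big1 ?addr0.
  by move=> /eqP; rewrite mulf_eq0 (negPf ce) => /eqP.
by move=> f' /andP[_ f'e]; rewrite Hu // mulr0.
Qed.

Lemma pow_vec0 (k : R) : pow_vec k 0 = 0 :> 'rV[R]_2.
Proof. by apply/rowP => i; rewrite !mxE sgr0 mul0r. Qed.

Lemma tight_not_rigid_minus p e (v0 : vertex G) : tight 2 2 G ->
  ~ quotient_rigid p (predC1 e).
Proof.
move=> /tight_card sz /(quotient_rigid_card v0).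
have -> : [set f | predC1 e f] = [set~ e] by apply/setP => f; rewrite !inE.
have : (0 < #|edge G|)%N by apply/card_gt0P; exists e.
by rewrite cardsC1; lia.
Qed.

(** A degenerate edge has a zero row; dropping it would keep the placement rigid with too few edges.
    This makes a rigid placement a legitimate competitor in [regular]. *)
Lemma tight_rigid_configuration p (v0 : vertex G) : tight 2 2 G ->
  quotient_rigid p predT -> is_configuration act m p.
Proof.
move=> tG rp x y [e Oe] xy.
have ev : edge_vector L p (gain_edge_of m e) = 0.
  case: Oe => g [[xE yE]|[yE xE]]; rewrite -(derived_edge_vector p e g).
    by rewrite -xE -yE xy subrr.
  by rewrite -xE -yE xy subrr.
apply: (tight_not_rigid_minus (p := p) (e := e) v0 tG) => u Hu; apply: rp => f _.
have [->|fe] := eqVneq f e; last exact: Hu.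
by rewrite /row ev pow_vec0 dotE !mxE; ring.
Qed.

Lemma rigid_motion_dim p (v0 : vertex G) :
  quotient_rigid p predT -> sym_motion_dim q act m p 2.
Proof.
move=> rp; exists (fun i _ => delta_mx 0 i); split.
  move=> c /(congr1 (fun f => f (0, v0))); rewrite fct_sumE => /rowP h i.
  have := h i; rewrite mxE summxE (bigD1 i) //= !mxE !eqxx mulr1 big1 ?addr0 //.
  by move=> j ji; rewrite !mxE eqxx (negPf (_ : i != j)) ?mulr0 // eq_sym.
have cE (c : 'I_2 -> R) (x : derived_vertex G) :
    (\sum_i c i *: (fun _ : derived_vertex G => delta_mx 0 i : 'rV[R]_2)) x =
    \row_i c i.
  rewrite fct_sumE; apply/rowP => i; rewrite summxE (bigD1 i) //= !mxE !eqxx.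
  rewrite mulr1 big1 ?addr0 // => j ji; rewrite !mxE eqxx.
  by rewrite (negPf (_ : i != j)) ?mulr0 // eq_sym.
move=> u; split=> [|[c ->]].
  move=> /(sym_inf_motionP _ derived_adjP)[u0 /rp h ->].
  exists (u0 v0 0); apply/funext => x; rewrite cE; apply/rowP => i.
  by rewrite mxE (h _ v0).
apply/(sym_inf_motionP _ derived_adjP); exists (fun _ => \row_i c i).
  by move=> e _; rewrite subrr dotE !mxE; ring.
by apply/funext => x; rewrite cE.
Qed.

(** A nonconstant motion would be linearly independent of the two unit translations: comparing a
    relation at [x] and at [y] kills its coefficient. *)
Lemma dim2_rigid p n (v0 : vertex G) : sym_motion_dim q act m p n -> (n <= 2)%N ->
  quotient_rigid p predT.
Proof.
move=> hn n2 u Hu x y; apply/eqP/negPn/negP => uxy.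
pose f (j : 'I_3) : vertex G -> 'rV[R]_2 :=
  if j == 0 then fun _ => delta_mx 0 0
  else if j == 1 then fun _ => delta_mx 0 1 else u.
have Sf j : sym_inf_motion q act (derived_adj m) p (fun z => f j z.2).
  apply/(sym_inf_motionP _ derived_adjP); exists (f j) => //; rewrite /f.
  case: ifP => _; first by move=> e _; rewrite subrr dotE !mxE; ring.
  case: ifP => _; first by move=> e _; rewrite subrr dotE !mxE; ring.
  exact: Hu.
have [d [j dj] dP] := has_dim_dependent hn Sf n2.
have rel v : d 0 *: delta_mx 0 0 + d 1 *: delta_mx 0 1 + d (2%:R : 'I_3) *: u v = 0.
  have := congr1 (fun g => g (0, v)) dP; rewrite fct_sumE.
  rewrite (eq_bigr (fun j => d j *: f j v)) // !big_ord_recl big_ord0 addr0 addrA.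
  have -> : lift ord0 (lift ord0 ord0) = 2%:R :> 'I_3 by apply/val_inj.
  by have -> : lift ord0 ord0 = 1 :> 'I_3 by apply/val_inj.
have d2 : d 2%:R = 0.
  have : d 2%:R *: (u x - u y) = 0.
    have e : d 2%:R *: u x = d 2%:R *: u y.
      by apply: (addrI (d 0 *: delta_mx 0 0 + d 1 *: delta_mx 0 1)); rewrite !rel.
    by rewrite scalerBr e subrr.
  by move=> /eqP; rewrite scaler_eq0 subr_eq0 (negPf uxy) orbF => /eqP.
have := rel x; rewrite d2 scale0r addr0 => /rowP h.
have d0 : d 0 = 0 by have := h 0; rewrite !mxE /= mulr1 mulr0 addr0.
have d1 : d 1 = 0 by have := h 1; rewrite !mxE /= mulr1 mulr0 add0r.
move: dj; apply/negP; rewrite negbK; apply/eqP.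
case: j => -[|[|[|//]]] hj.
- by rewrite -[RHS]d0; congr d; apply/val_inj.
- by rewrite -[RHS]d1; congr d; apply/val_inj.
- by rewrite -[RHS]d2; congr d; apply/val_inj.
Qed.

End SymmetricMotions.

Theorem theorem5p1 (R : realType) (q : R) (hq1 : 1 < q) (hq2 : q != 2)
    (w1 w2 : 'rV[R]_2) (hw : free [:: w1; w2])
    (G : multigraph) (hV : (0 < #|vertex G|)%N)
    (m : edge G -> Z2) (hm : is_gain m)
    (p : vertex G -> 'rV[R]_2)
    (hp : is_configuration (lattice_act w1 w2) m p)
    (hreg : regular q (lattice_act w1 w2) m p) :
  min_sym_inf_rigid q (lattice_act w1 w2) m p <-> tight 2 2 G.
Proof.
have /card_gt0P[v0 _] := hV.
have rigidP := sym_inf_rigidP q w1 w2 p (derived_adjP m).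
have minusP e := sym_inf_rigidP q w1 w2 p (derived_adj_minusP hm e).
split=> [[/rigidP rp hmin]|tG].
  have sp : sparse 2 2 G.
    by apply: (min_rigid_sparse (p := p)) rp => e /minusP; exact: hmin.
  split=> //; have := quotient_rigid_card v0 rp.
  have -> : [set e | @predT (edge G) e] = [set: edge G].
    by apply/setP => e; rewrite !inE.
  rewrite cardsT => lo.
  (* Sparsity gives no bound for the empty edge set; there the rigidity count forces a single
     vertex. *)
  have [E0|E1] := leqP #|edge G| 0.
    by move: E0 hV lo; move: #|edge G| #|vertex G| => a b; clear; lia.
  have := sp [set: vertex G] [set: edge G]; rewrite !cardsT => /(_ _ E1) up.
  have {}up := up (fun e _ => conj (finset.in_setT _) (finset.in_setT _)).
  by move: lo up; move: #|edge G| #|vertex G| => a b; clear; lia.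
split; last by move=> e /minusP; exact: tight_not_rigid_minus tG.
have k0 : 0 < q - 1 by rewrite subr_gt0.
have k1 : q - 1 != 1 by apply: contra hq2 => /eqP h; apply/eqP; lra.
have [p' _ rp'] := tight_on_rigid k0 k1 (lattice_pointN w1 w2)
  (lattice_point_inj hw) [::] (tight_on_gain_edges hm tG).
have qp' : quotient_rigid q w1 w2 m p' predT.
  move=> u Hu x y; apply: (rp' u); rewrite ?finset.in_setT //.
  by move=> _ /mapP[e _ ->]; exact: Hu.
(* Regularity compares [p] with the rigid placement [p'], whose motion space has dimension 2. *)
have [n hn nmin] := hreg.
have n2 := nmin _ _ (tight_rigid_configuration v0 tG qp') (rigid_motion_dim v0 qp').
by apply/rigidP; exact: dim2_rigid v0 hn n2.
Qed.
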